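(* For every $1\le\alpha<\beta<\infty$ and all finite sequences $\eta,\eta'\in[0,1)^{<\omega}$ with $\eta<_{\mathrm{lex}}\eta'$, $$\mathbf{E}_{\mathrm{Id}^{\alpha}}<_B\mathbf{E}_{\mathrm{Id}^{\alpha}/l_{\eta}}<_B\mathbf{E}_{\mathrm{Id}^{\alpha}/l_{\eta'}}<_B\mathbf{E}_{\mathrm{Id}^{\beta}}.$$
   Context: For $f\colon[0,1]\to[0,\infty)$, $\mathbf{E}_f$ is the relation on $[0,1]^{\omega}$ given by $(x_n)\,\mathbf{E}_f\,(y_n)\iff\sum_{n<\omega}f(|y_n-x_n|)<\infty$. $\mathrm{Id}^{\alpha}$ is the function $x\mapsto x^{\alpha}$ on $[0,1]$. Define $t_n\colon(0,1]\to\mathbb{R}$ by $t_0(x)=1-\log(x)$ and $t_{n}(x)=1+\log(t_{n-1}(x))$ for $n\ge1$. $[0,1)^{<\omega}$ is the set of finite sequences of elements of $[0,1)$. For $\eta=(\eta_0,\dots,\eta_{|\eta|-1})\in[0,1)^{<\omega}$, let $l_{\eta}(x)=\prod_{i<|\eta|}t_i(x)^{\eta_i}$ $(0<x\le1)$; so $l_{\emptyset}=1$. The function $\mathrm{Id}^{\alpha}/l_{\eta}$ is $x\mapsto x^{\alpha}/l_{\eta}(x)$ for $0<x\le1$, with value $0$ at $0$ (the relations $\mathbf{E}_{\mathrm{Id}^{\alpha}/l_\eta}$ are equivalence relations). $<_{\mathrm{lex}}$ denotes the lexicographic order on $[0,1)^{<\omega}$. For equivalence relations $E$ on a Polish space $X$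 and $F$ on a Polish space $Y$, $E\le_B F$ means there is a Borel function $\vartheta\colon X\to Y$ with $x\,E\,x'\iff\vartheta(x)\,F\,\vartheta(x')$ for all $x,x'\in X$; $E<_B F$ means $E\le_B F$ and $F\not\le_B E$.
   Formalization: The first link is claimed only when η is not empty or all zeros, and the second only when η' is not η followed by zeros; in exactly these excluded cases the two functions coincide, so strict reducibility fails. *)

(* Defs.v *)
From HB Require Import structures.
From mathcomp Require Import all_boot all_order all_algebra.
From mathcomp Require Import all_classical all_reals all_analysis.
Import Order.TTheory GRing.Theory Num.Theory.
Import numFieldNormedType.Exports.

Set Implicit Arguments.
Unset Strict Implicit.
Unset Printing Implicit Defensive.

Local Open Scope classical_set_scope.
Local Open Scope ring_scope.

(* [0,1]^omega with the product of the subspace topologies of [0,1]. *)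
Definition hilbert_cube (R : realType) : topologicalType :=
  prod_topology (fun _ : nat => set_type (`[0%R, 1%R]%classic : set R)).

(* <<s open >> is the Borel sigma-algebra. *)
Definition borel_fun (X Y : topologicalType) (h : X -> Y) : Prop :=
  forall B : set Y, <<s @open Y >> B -> <<s @open X >> (h @^-1` B).

Definition borel_reducible (X Y : topologicalType)
    (E : X -> X -> Prop) (F : Y -> Y -> Prop) : Prop :=
  exists2 h : X -> Y, borel_fun h & forall x x', E x x' <-> F (h x) (h x').

Definition strictly_borel_reducible (X Y : topologicalType)
    (E : X -> X -> Prop) (F : Y -> Y -> Prop) : Prop :=
  borel_reducible E F /\ ~ borel_reducible F E.

(* Only the values of [f] on [0,1] matter. They are meant to be nonnegative, so
   that the extended-real sum is < +oo iff the series converges. *)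
Definition Erel (R : realType) (f : R -> R) (x y : hilbert_cube R) : Prop :=
  (\sum_(0 <= n <oo) (f `|set_val (y n) - set_val (x n)|)%:E < +oo)%E.

Fixpoint tlog (R : realType) (n : nat) (x : R) : R :=
  if n is m.+1 then 1 + ln (tlog m x) else 1 - ln x.

Definition lprod (R : realType) (eta : seq R) (x : R) : R :=
  \prod_(i < size eta) tlog i x `^ eta`_i.

Definition Id_pow (R : realType) (alpha : R) (x : R) : R := x `^ alpha.

Definition Id_pow_div (R : realType) (alpha : R) (eta : seq R) (x : R) : R :=
  if x == 0 then 0 else x `^ alpha / lprod eta x.

(* Lexicographic order, a proper prefix being smaller than its extensions. *)
Definition lex_lt (R : realType) (eta eta' : seq R) : Prop :=
  ((eta : seqlexi R) < (eta' : seqlexi R))%O.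

Definition zero_extension (R : realType) (eta eta' : seq R) : Prop :=
  exists k : nat, eta' = eta ++ nseq k 0.

(* Appending zero exponents is strictly increasing (or trivial, for k = 0) for
   the lexicographic order but does not change the function, so no strict
   reducibility can hold between the corresponding relations. *)
Lemma Id_pow_div_zero_extension (R : realType) (alpha : R) (eta eta' : seq R) :
  zero_extension eta eta' -> Id_pow_div alpha eta' = Id_pow_div alpha eta.
Proof.
move=> [k ->]; apply/funext => x; rewrite /Id_pow_div; case: eqP => // _.
congr (_ / _); rewrite /lprod size_cat size_nseq big_split_ord /=.
rewrite [X in _ * X]big1 ?mulr1 => [|i _].
  by apply: eq_bigr => i _; rewrite nth_cat ltn_ord.
by rewrite nth_cat ltnNge leq_addr /= nth_nseq if_same powRr0.
Qed.

Lemma Id_pow_div_nil (R : realType) (alpha x : R) :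
  alpha != 0 -> Id_pow_div alpha [::] x = Id_pow alpha x.
Proof.
move=> a0; rewrite /Id_pow_div /Id_pow /lprod; case: eqP => [->|_].
  by rewrite powR0.
by rewrite big_ord0 divr1.
Qed.

(* Main.v *)
(** All the functions involved are [f_e(x) = prod_i tau_i(x) ^ - e_i], where [tau_0(x) = 1 / x]
    and [tau_(i+1) = 1 + ln tau_i], and the chain is ordered by the lexicographic order of the
    exponents [alpha, eta_0, eta_1, ...]. If [e < e'], [f = f_e] and [g = f_e'], then [L = f / g]
    is almost monotone and tends to infinity at [0].

    Reduction of [E_f] to [E_g]: send [x] in [[0,1]] to the values [kappa_k w(2^k x)] for
    [w = sin, cos]. Points at distance [2^-j] are then separated by about
    [sum_(k <= j) g(kappa_k 2^(k-j)) + sum_(k > j) g(kappa_k)]. For [kappa_k = 2^-k mu_k], the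
    terms with [k <= j] are about [mu_k ^ e'_0 g(2^-j)]; taking for [mu_k ^ e'_0] the increments of
    the running maximum of [L(2^-k)], the sum telescopes to [L(2^-j) g(2^-j) = f(2^-j)].

    No reduction of [E_g] to [E_f]: by Baire category, such a reduction is, up to summable errors,
    a product of maps on blocks, the [n]-th of them being defined on the grid of the [i / m_n].
    Going from [0] to [1] costs at least a constant in almost every block, so some step of length
    [1 / m_n] costs at least [c f(1 / m_n)], because [f x / x] is nondecreasing and [f] is
    supermultiplicative. As [g / f] tends to [0], one can choose the [m_n] such that
    [sum g(1 / m_n)] converges and [sum f(1 / m_n)] diverges, a contradiction. *)

Require Import Defs.
From mathcomp Require Import all_boot all_order all_algebra.
From mathcomp Require Import all_classical all_reals all_analysis.
From mathcomp Require Import ring lra.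
Import Order.TTheory GRing.Theory Num.Theory.
Import numFieldNormedType.Exports.
Local Open Scope classical_set_scope.
Local Open Scope ring_scope.

(** * Iterated logarithms *)

Section IteratedLogarithms.
Context {R : realType}.
Implicit Types (x y s : R) (a : nat -> R) (n N p : nat).

(* Starting from [1 / x] puts powers and iterated logarithms on the same footing:
   [tlog n] is [tau n.+1]. *)
Fixpoint tau n x : R := if n is m.+1 then 1 + ln (tau m x) else x^-1.

Lemma tlog_tau n x : 0 < x -> tlog n x = tau n.+1 x.
Proof.
move=> x0; elim: n => [|n IHn] /=; first by rewrite lnV.
by rewrite IHn.
Qed.

Lemma tau_ge1 n x : 0 < x <= 1 -> 1 <= tau n x.
Proof.
move=> /andP[x0 x1]; elim: n => [|n IHn] /=; first by rewrite invf_ge1.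
by rewrite lerDl ln_ge0.
Qed.

Lemma tau_gt0 n x : 0 < x <= 1 -> 0 < tau n x.
Proof. by move=> x01; apply: lt_le_trans ltr01 (tau_ge1 n x x01). Qed.

Lemma tau1 n : tau n 1 = 1 :> R.
Proof. by elim: n => [|n /= ->]; rewrite /= ?invr1 // ln1 addr0. Qed.

Lemma tau_le n x y : 0 < x <= y -> y <= 1 -> tau n y <= tau n x.
Proof.
move=> /andP[x0 xy] y1; have y0 := lt_le_trans x0 xy.
elim: n => [|n IHn] /=; first by rewrite lef_pV2.
by rewrite lerD2l ler_ln ?posrE ?tau_gt0 ?x0 ?y0 ?(le_trans xy).
Qed.

Lemma ln_le_sub1 x : 0 < x -> 1 + ln x <= x.
Proof. by move=> x0; have := expR_ge1Dx (ln x); rewrite lnK ?posrE. Qed.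

(** With [u] and [v] the logarithms at the previous stage, both nonnegative,
    [1 + (u + v) <= (1 + u) * (1 + v)]. *)
Lemma tauM n x y : 0 < x <= 1 -> 0 < y <= 1 ->
  tau n (x * y) <= tau n x * tau n y.
Proof.
move=> x01 y01; have [x0 x1] := andP x01; have [y0 y1] := andP y01.
have xy01 : 0 < x * y <= 1 by rewrite mulr_gt0 // mulr_ile1 // ltW.
elim: n => [|n IHn] /=; first by rewrite invfM.
apply: (@le_trans _ _ (1 + (ln (tau n x) + ln (tau n y)))).
  by rewrite lerD2l -lnM ?posrE ?tau_gt0 // ler_ln ?posrE ?mulr_gt0 ?tau_gt0.
have := ln_ge0 (tau_ge1 n x x01); have := ln_ge0 (tau_ge1 n y y01).
by nra.
Qed.

Lemma powR_01 x s : 0 < x <= 1 -> 0 <= s -> 0 < x `^ s <= 1.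
Proof.
by move=> x01 s0; rewrite powR_gt0 /= -?[leRHS](powRr0 x) ?ger_powR //; case/andP: x01.
Qed.

(** The first logarithm turns the power into the factor [s], and [1 + ln s <= s] keeps that factor
    from growing at later stages. At index [0] the power is still there, hence [n.+1]. *)
Lemma tau_powR n x s : 0 < x <= 1 -> 1 <= s ->
  tau n.+1 (x `^ s) <= s * tau n.+1 x.
Proof.
move=> x01 s1; have [x0 x1] := andP x01.
have s0 : 0 < s by lra.
have xs01 : 0 < x `^ s <= 1 by exact: (powR_01 _ _ _ (ltW s0)).
elim: n => [|n IHn].
  rewrite /= !lnV ?posrE ?powR_gt0 // ln_powR mulrDr mulr1.
  by rewrite mulrN lerD2r.
rewrite /= -/(tau n.+1 (x `^ s)) -/(tau n.+1 x).
have h : ln (tau n.+1 (x `^ s)) <= ln s + ln (tau n.+1 x).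
  by rewrite -lnM ?posrE ?tau_gt0 // ler_ln ?posrE ?mulr_gt0 ?tau_gt0.
have := ln_ge0 (tau_ge1 n.+1 x x01); have := ln_le_sub1 s s0; nra.
Qed.

Lemma tau_ratio_ge1 n x y : 0 < y <= x -> x <= 1 -> 1 <= tau n y / tau n x.
Proof.
move=> /andP[y0 yx] x1; have x01 : 0 < x <= 1 by rewrite x1 (lt_le_trans y0).
by rewrite ler_pdivlMr ?tau_gt0 // mul1r tau_le ?y0.
Qed.

(** With [A <= A'] the logarithms of [tau n x] and [tau n y], both nonnegative,
    [1 + A' <= (1 + A) * (1 + (A' - A))]. *)
Lemma tau_ratio n x y : 0 < y <= x -> x <= 1 ->
  tau n.+1 y / tau n.+1 x <= 1 + ln (tau n y / tau n x).
Proof.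
move=> yx x1; have [y0 _] := andP yx.
have x01 : 0 < x <= 1 by rewrite x1 andbT; move: yx; lra.
have y01 : 0 < y <= 1 by move: yx; lra.
rewrite ler_pdivrMr ?tau_gt0 //= ln_div ?posrE ?tau_gt0 //.
have := ln_ge0 (tau_ge1 n x x01).
have : ln (tau n x) <= ln (tau n y).
  by rewrite ler_ln ?posrE ?tau_gt0 // tau_le.
nra.
Qed.

Lemma ln_le_powR s x : 1 <= x -> 0 < s <= 1 -> 1 + ln x <= s^-1 * x `^ s.
Proof.
move=> x1 /andP[s0 s1]; have x0 : 0 < x by lra.
rewrite mulrC ler_pdivlMr // /powR (gt_eqF x0).
by apply: le_trans (expR_ge1Dx _); have := ln_ge0 x1; nra.
Qed.

(** One logarithm is gained in passing from [p] to [p.+1]; all further ones are discarded by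
    [1 + ln r <= r]. *)
Lemma tau_ratio_tail n p x y : 0 < y <= x -> x <= 1 -> (p < n)%N ->
  tau n y / tau n x <= 1 + ln (tau p y / tau p x).
Proof.
move=> yx x1; elim: n => // n IHn; rewrite ltnS leq_eqVlt => /orP[/eqP <-|pn].
  exact: tau_ratio.
apply: le_trans (tau_ratio n x y yx x1) _; apply: le_trans (IHn pn).
by apply: ln_le_sub1; apply: lt_le_trans (tau_ratio_ge1 n x y yx x1).
Qed.

Lemma tau0E x : tau 0 x = x^-1. Proof. by []. Qed.

Lemma tauSE n x : tau n.+1 x = 1 + ln (tau n x). Proof. by []. Qed.

(** The reciprocal of the functions under study: a quotient of two of them is again of this form,
    with the differences of the exponents. *)
Definition wt a N x := \prod_(i < N) tau i x `^ a i.

Lemma wt_gt0 a N x : 0 < x <= 1 -> 0 < wt a N x.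
Proof. by move=> x01; rewrite /wt; apply: prodr_gt0 => i _; rewrite powR_gt0 ?tau_gt0. Qed.

Lemma wtB a b N x : 0 < x <= 1 -> wt (fun i => b i - a i) N x = wt b N x / wt a N x.
Proof.
move=> x01; rewrite /wt -prodf_div; apply: eq_bigr => i _.
by rewrite powRB // (gt_eqF (tau_gt0 _ _ x01)) implybT.
Qed.

(* Ratios satisfy [r_(i+1) <= 1 + ln r_i], so the factors of index beyond [p] are of lower
   order than [r_p ^ a_p]. *)
Lemma wt_first_pos_growth a N p : (p < N)%N -> (forall i, (i < p)%N -> a i = 0) ->
  0 < a p ->
  exists c s : R, [/\ 0 < c, 0 < s & forall x y, 0 < y <= x -> x <= 1 ->
    c * (tau p y / tau p x) `^ s * wt a N x <= wt a N y].
Proof.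
move=> pN a0 ap.
pose D := 1 + \sum_(i < N) `|a i|.
have D1 : 1 <= D by rewrite /D lerDl sumr_ge0.
have aD (i : 'I_N) : `|a i| <= D.
  by rewrite /D (bigD1 i) //= addrCA lerDl addr_ge0 // sumr_ge0.
have N1 : 1 <= N%:R :> R by rewrite ler1n; case: N pN {D D1 aD}.
have DN : 1 <= D * N%:R by nra.
(* Up to constants, the factors of index beyond [p] will lose at most [r ^ (e * D)] each; this [e]
   makes the total loss at most [r ^ (a p / 2)], half of the gain. *)
pose e := Num.min 1 (a p / (2 * (D * N%:R))).
have e0 : 0 < e by rewrite lt_min ltr01 /= divr_gt0 // mulr_gt0 //; lra.
have e1 : e <= 1 by rewrite ge_min lexx.
have eD : e * D * N%:R <= a p / 2.
  rewrite -mulrA -ler_pdivlMr; last by lra.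
  by rewrite ge_min; apply/orP; right; rewrite -mulrA -invfM.
exists ((e `^ D) ^+ N), (a p / 2); split.
- by rewrite exprn_gt0 // powR_gt0.
- by rewrite divr_gt0.
move=> x y yx x1.
have x01 : 0 < x <= 1 by rewrite x1 andbT; move: yx; lra.
have y01 : 0 < y <= 1 by move: yx; lra.
have r1 := tau_ratio_ge1 p x y yx x1.
set r := _ / _ in r1 *.
rewrite -ler_pdivlMr ?wt_gt0 // /wt -prodf_div.
rewrite (eq_bigr (fun i : 'I_N => (tau i y / tau i x) `^ a i)); last first.
  move=> i _; rewrite powRM ?invr_ge0 ?ltW ?tau_gt0 //; congr (_ * _).
  by rewrite -powR_inv1 ?powRrM ?(powRAC _ (-1)) ?powR_inv1 ?powR_ge0 ?ltW ?tau_gt0.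
rewrite (bigD1 (Ordinal pN)) //=; rewrite -/r.
have r0 : 0 < r by lra.
(* This is [(e^-1 * r ^ e) ^ (- D)]: beyond [p] the ratios are at most [e^-1 * r ^ e] and the
   exponents at least [- D]. *)
pose q := e `^ D * r `^ (- (e * D)).
have q0 : 0 < q by rewrite mulr_gt0 ?powR_gt0.
have q1 : q <= 1.
  rewrite mulr_ile1 ?powR_ge0 //.
    by rewrite -(powRr0 e) ger_powR ?e0 //; lra.
  by rewrite -(powRr0 r) ler_powR // oppr_le0 mulr_ge0 ?ltW //; lra.
have hq (i : 'I_N) : i != Ordinal pN -> q <= (tau i y / tau i x) `^ a i.
  move=> ip; have ti1 := tau_ratio_ge1 i x y yx x1.
  have ti0 : 0 < tau i y / tau i x by lra.
  have [ilt|] := ltnP i p; first by rewrite a0 // powRr0.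
  rewrite leq_eqVlt => /orP[/eqP pi|pi].
    by case/eqP: ip; apply/val_inj; rewrite /= pi.
  have h1 : tau i y / tau i x <= e^-1 * r `^ e.
    apply: le_trans (tau_ratio_tail _ _ _ _ yx x1 pi) _.
    by apply: ln_le_powR => //; rewrite e0.
  apply: (@le_trans _ _ ((tau i y / tau i x) `^ (- D))); last first.
    by rewrite ler_powR //; have := aD i; rewrite ler_norml => /andP[].
  have -> : q = (e^-1 * r `^ e) `^ (- D).
    rewrite powRM ?powR_ge0 ?invr_ge0 ?(ltW e0) // -powR_inv1 ?(ltW e0) //.
    by rewrite -!powRrM /q; congr (_ `^ _ * _ `^ _); ring.
  have er0 : 0 < e^-1 * r `^ e by rewrite mulr_gt0 ?invr_gt0 ?powR_gt0.
  rewrite !powRN lef_pV2 ?posrE ?powR_gt0 //.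
  apply: ge0_ler_powR => //; first lra.
    by rewrite nnegrE ltW.
  by rewrite nnegrE ltW.
have hprod : q ^+ N <= \prod_(i < N | i != Ordinal pN) (tau i y / tau i x) `^ a i.
  apply: (@le_trans _ _ (\prod_(i < N | i != Ordinal pN) q)).
    rewrite prodr_const ler_wiXn2l ?(ltW q0) //.
    by apply: leq_trans (max_card _) _; rewrite card_ord.
  by apply: ler_prod => k kp; rewrite (ltW q0) hq.
apply: le_trans (ler_wpM2l (powR_ge0 r (a p)) hprod).
rewrite /q exprMn mulrCA ler_wpM2l ?exprn_ge0 ?powR_ge0 //.
rewrite -powR_mulrn ?powR_ge0 // -powRrM -powRD; last by rewrite (gt_eqF r0) implybT.
by rewrite ler_powR //; lra.
Qed.

End IteratedLogarithms.

Arguments tau : simpl never.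

(** * The functions [x ^ alpha / l_eta] *)

Section PowerLog.
Context {R : realType}.
Implicit Types (x y s : R) (a b : nat -> R) (n N p : nat).

Definition lg a N x := \prod_(i < N) tau i.+1 x `^ a i.+1.

(** Index [0] of [a] is the power of [x], the next [N] entries are the exponents of the logarithms.
    Infinite sequences with a common [N] make functions given by lists of different lengths
    comparable. *)
Definition plog a N x := if x == 0 then 0 else x `^ a 0%N / lg a N x.

Lemma lg_gt0 a N x : 0 < x <= 1 -> 0 < lg a N x.
Proof. by move=> x01; rewrite /lg; apply: prodr_gt0 => i _; rewrite powR_gt0 ?tau_gt0. Qed.

Lemma plogE a N x : 0 < x -> plog a N x = x `^ a 0%N / lg a N x.
Proof. by move=> x0; rewrite /plog gt_eqF. Qed.

Lemma plog_wt a N x : 0 < x <= 1 -> plog a N x = (wt a N.+1 x)^-1.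
Proof.
move=> /andP[x0 x1]; rewrite plogE // /wt big_ord_recl /= invfM; congr (_ * _).
by rewrite tau0E -[x^-1]powR_inv1 ?ltW // -powRrM mulN1r powRN invrK.
Qed.

Lemma plog0 a N : plog a N 0 = 0.
Proof. by rewrite /plog eqxx. Qed.

Lemma plog_gt0 a N x : 0 < x <= 1 -> 0 < plog a N x.
Proof. by move=> x01; rewrite plog_wt // invr_gt0 wt_gt0. Qed.

Lemma plog_ge0 a N x : 0 <= x <= 1 -> 0 <= plog a N x.
Proof.
move=> /andP[]; rewrite le_eqVlt => /orP[/eqP <- _|x0 x1]; first by rewrite plog0.
by rewrite ltW // plog_gt0 ?x0.
Qed.

Lemma lg1 a N : lg a N 1 = 1 :> R.
Proof. by rewrite /lg big1 // => i _; rewrite tau1 powR1. Qed.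

Lemma plog1 a N : plog a N 1 = 1 :> R.
Proof. by rewrite plogE // lg1 powR1 divr1. Qed.

(** Each [tau i.+1 x] is at most a constant times [x ^ (- e)], where [e] times the sum of the
    absolute exponents stays below [s]. *)
Lemma lg_powR_le a N s : 0 < s -> exists2 K, 0 < K &
  forall x, 0 < x <= 1 -> lg a N x <= K * x `^ (- s).
Proof.
move=> s0; pose A := 1 + \sum_(i < N) `|a i.+1|.
have A1 : 1 <= A by rewrite /A lerDl sumr_ge0.
pose e := Num.min 1 (s / A).
have e0 : 0 < e by rewrite lt_min ltr01 divr_gt0 //; lra.
have e1 : e <= 1 by rewrite ge_min lexx.
have eA : e * A <= s by rewrite -ler_pdivlMr ?ge_min ?lexx ?orbT //; lra.
exists (e^-1 `^ A); first by rewrite powR_gt0 ?invr_gt0.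
move=> x x01; have [x0 x1] := andP x01.
have ex : 1 <= e^-1 * (x^-1) `^ e.
  rewrite mulr_ege1 ?invf_ge1 //.
  by rewrite -(powRr0 (x^-1)) ler_powR ?invf_ge1  ?(ltW e0).
apply: (@le_trans _ _ (\prod_(i < N) (e^-1 * (x^-1) `^ e) `^ `|a i.+1|)).
  rewrite /lg; apply: ler_prod => i _; rewrite powR_ge0 /=.
  apply: (@le_trans _ _ (tau i.+1 x `^ `|a i.+1|)).
    by rewrite ler_powR ?tau_ge1 // ler_norm.
  rewrite ge0_ler_powR ?nnegrE ?(ltW (tau_gt0 _ _ x01)) //; first lra.
  (* At the base point [1] every [tau] equals [1], so the bound on ratios becomes a bound on
     [tau i.+1 x]. *)
  have := @tau_ratio_tail R i.+1 0 1 x x01 (lexx 1) isT.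
  rewrite !tau1 !divr1 tau0E => h; apply: le_trans h _.
  by apply: ln_le_powR; rewrite ?invf_ge1 ?e0.
have -> : \prod_(i < N) (e^-1 * x^-1 `^ e) `^ `|a i.+1| =
    (e^-1 * x^-1 `^ e) `^ (\sum_(i < N) `|a i.+1|).
  rewrite (big_morph (fun t => (e^-1 * x^-1 `^ e) `^ t) (id1 := 1) (op1 := *%R)) //.
    by move=> u v; rewrite powRD // (gt_eqF (lt_le_trans ltr01 ex)) implybT.
  exact: powRr0.
apply: (@le_trans _ _ ((e^-1 * x^-1 `^ e) `^ A)).
  by rewrite ler_powR // /A lerDr.
rewrite powRM ?powR_ge0 ?invr_ge0 ?(ltW e0) // -powRrM.
rewrite ler_wpM2l ?powR_ge0 // -(powR_inv1 (ltW x0)) -powRrM mulN1r.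
by rewrite ger_powR // lerN2.
Qed.

Variables (a : nat -> R) (N : nat).
Hypothesis a_ge0 : forall i, 0 <= a i.

Lemma lg_ge1 x : 0 < x <= 1 -> 1 <= lg a N x.
Proof.
move=> x01; rewrite /lg; elim/big_ind: _ => // [u v u1 v1|i _]; first by nra.
by rewrite -(powRr0 (tau i.+1 x)) ler_powR ?tau_ge1.
Qed.

Lemma lg_le x y : 0 < x <= y -> y <= 1 -> lg a N y <= lg a N x.
Proof.
move=> xy y1; rewrite /lg; apply: ler_prod => i _; rewrite powR_ge0 /=.
have x01 : 0 < x <= 1 by move: xy; lra.
have y01 : 0 < y <= 1 by move: xy; lra.
by rewrite ge0_ler_powR ?nnegrE ?(ltW (tau_gt0 _ _ _)) // tau_le.
Qed.

Lemma lgM x y : 0 < x <= 1 -> 0 < y <= 1 -> lg a N (x * y) <= lg a N x * lg a N y.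
Proof.
move=> x01 y01; rewrite /lg -big_split /=; apply: ler_prod => i _.
have xy01 : 0 < x * y <= 1 by move: x01 y01; nra.
rewrite powR_ge0 /= -powRM ?(ltW (tau_gt0 _ _ _)) //.
rewrite ge0_ler_powR ?nnegrE ?(ltW (tau_gt0 _ _ _)) ?tauM //.
by rewrite mulr_ge0 ?(ltW (tau_gt0 _ _ _)).
Qed.

Lemma lg_powR s : 1 <= s -> exists2 K, 0 < K &
  forall x, 0 < x <= 1 -> lg a N (x `^ s) <= K * lg a N x.
Proof.
move=> s1; have s0 : 0 < s by lra.
exists (\prod_(i < N) s `^ a i.+1); first by apply: prodr_gt0 => i _; rewrite powR_gt0.
move=> x x01; have [x0 x1] := andP x01.
have xs01 : 0 < x `^ s <= 1 by exact: (powR_01 _ _ _ (ltW s0)).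
rewrite /lg -big_split /=; apply: ler_prod => i _.
rewrite powR_ge0 /= -powRM ?(ltW (tau_gt0 _ _ _)) ?(ltW s0) //.
rewrite ge0_ler_powR ?nnegrE ?(ltW (tau_gt0 _ _ _)) ?tau_powR //.
by rewrite mulr_ge0 ?(ltW (tau_gt0 _ _ _)) ?(ltW s0).
Qed.

Hypothesis a0_ge1 : 1 <= a 0%N.

Local Notation f := (plog a N).

(** Since [a 0 - 1] is nonnegative and [lg] is nonincreasing, [f x / x] is nondecreasing; the
    product form includes [x = 0]. *)
Lemma plog_mul_le x y : 0 <= x <= y -> y <= 1 -> f x * y <= f y * x.
Proof.
move=> /andP[]; rewrite le_eqVlt => /orP[/eqP <- _ _|x0 xy y1].
  by rewrite plog0 mul0r mulr0.
have y0 : 0 < y by lra.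
have x01 : 0 < x <= 1 by lra.
have y01 : 0 < y <= 1 by lra.
rewrite !plogE //.
have e z : 0 < z -> z `^ a 0%N = z * z `^ (a 0%N - 1).
  by move=> z0; rewrite mulr_powRB1 ?(ltW z0) // (lt_le_trans ltr01 a0_ge1).
rewrite !e // -!mulrA (mulrA _ _ x) (mulrC _ x) (mulrA _ _ y) (mulrC _ y) !mulrA.
rewrite (mulrC y x) -!mulrA ler_pM2l // ler_pM2l //.
have h1 : x `^ (a 0%N - 1) <= y `^ (a 0%N - 1).
  by rewrite ge0_ler_powR ?nnegrE ?(ltW x0) ?(ltW y0) // subr_ge0.
apply: ler_pM => //; rewrite ?powR_ge0 ?invr_ge0 ?(ltW (lg_gt0 _ _ x x01)) //.
by rewrite lef_pV2 ?posrE ?lg_gt0 // lg_le // x0.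
Qed.

Lemma plog_le_id x : 0 <= x <= 1 -> f x <= x.
Proof.
by move=> x01; have := @plog_mul_le x 1 x01 (lexx 1); rewrite plog1 mulr1 mul1r.
Qed.

Lemma plog_le x y : 0 <= x <= y -> y <= 1 -> f x <= f y.
Proof.
move=> xy y1; have /orP[/eqP y0|y0] : (y == 0) || (0 < y).
  by rewrite -le0r; move: xy; lra.
  by have -> : x = y by move: xy; lra.
have := plog_mul_le x y xy y1.
have : 0 <= f y by rewrite plog_ge0 // ltW.
have : 0 <= f x by rewrite plog_ge0 //; move: xy; lra.
by move=> f0 g0 h; rewrite -(ler_pM2r y0); move: xy; nra.
Qed.

Lemma plog_supermul x y : 0 <= x <= 1 -> 0 <= y <= 1 -> f x * f y <= f (x * y).
Proof.
move=> /andP[]; rewrite le_eqVlt => /orP[/eqP <-|x0 x1]; first by rewrite !mul0r plog0 mul0r.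
move=> /andP[]; rewrite le_eqVlt => /orP[/eqP <-|y0 y1]; first by rewrite !mulr0 plog0 mulr0.
have x01 : 0 < x <= 1 by lra.
have y01 : 0 < y <= 1 by lra.
have xy01 : 0 < x * y <= 1 by nra.
have /andP[xy0 _] := xy01.
rewrite !plogE // mulrACA -powRM ?(ltW x0) ?(ltW y0) // -invfM.
by rewrite ler_wpM2l ?powR_ge0 // lef_pV2 ?posrE ?mulr_gt0 ?lg_gt0 // lgM.
Qed.

(** Half of [z] is at most the larger of [x] and [y], and supermultiplicativity gives
    [f z * f 2^-1 <= f (z / 2)]. *)
Lemma plog_quasi_triangle x y z : 0 <= x <= 1 -> 0 <= y <= 1 -> 0 <= z <= x + y ->
  z <= 1 -> f z <= (f 2^-1)^-1 * (f x + f y).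
Proof.
wlog xy : x y / x <= y.
  move=> wh x01 y01 zxy z1; have [xy|/ltW yx] := leP x y; first exact: wh.
  by rewrite [f x + _]addrC; apply: wh; rewrite // addrC.
move=> x01 y01 zxy z1.
have h0 : 0 < f 2^-1 by apply: plog_gt0; lra.
rewrite mulrC ler_pdivlMr //.
apply: (@le_trans _ _ (f (z * 2^-1))); first by apply: plog_supermul; move: zxy; lra.
apply: (@le_trans _ _ (f y)); first by apply: plog_le; move: zxy x01 y01; lra.
by rewrite lerDr plog_ge0.
Qed.

End PowerLog.

(** * Comparison of two functions at the first difference of their exponents *)

Section Comparison.
Context {R : realType}.
Variables (a b : nat -> R) (N p : nat).
Hypothesis pN : (p <= N)%N.
Hypothesis ab_eq : forall i, (i < p)%N -> a i = b i.
Hypothesis ab_lt : a p < b p.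

Local Notation f := (plog a N).
Local Notation g := (plog b N).

(** The quotient [f / g] is [wt (b - a)], whose first nonzero exponent, at [p], is positive. *)
Lemma plog_ratio_growth : exists c s : R, [/\ 0 < c, 0 < s & forall x y : R,
  0 < y <= x -> x <= 1 ->
  c * (tau p y / tau p x) `^ s * (f x / g x) <= f y / g y].
Proof.
have [|||c [s [c0 s0 h]]] := @wt_first_pos_growth R (fun i => b i - a i) N.+1 p.
- by [].
- by move=> i ip; rewrite ab_eq ?subrr.
- by rewrite subr_gt0.
exists c, s; split => // x y yx x1.
have x01 : 0 < x <= 1 by move: yx; lra.
have y01 : 0 < y <= 1 by move: yx; lra.
have := h x y yx x1; rewrite !wtB // !plog_wt // !invrK.
by rewrite ![_^-1 * _]mulrC.
Qed.

Lemma plog_ratio_almost_mono : exists2 C, 0 < C & forall x y : R,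
  0 < y <= x -> x <= 1 -> f x / g x <= C * (f y / g y).
Proof.
have [c [s [c0 s0 h]]] := plog_ratio_growth.
exists c^-1; first by rewrite invr_gt0.
move=> x y yx x1; rewrite ler_pdivlMl //.
apply: le_trans (h x y yx x1).
have x01 : 0 < x <= 1 by move: yx; lra.
have y01 : 0 < y <= 1 by move: yx; lra.
rewrite ler_wpM2r ?divr_ge0 ?(ltW (plog_gt0 _ _ x x01)) //.
rewrite ler_peMr ?(ltW c0) // -(powRr0 (tau p y / tau p x)).
by rewrite ler_powR ?tau_ratio_ge1 // ltW.
Qed.

Lemma tau_unbounded n (K : R) : exists2 x0 : R, 0 < x0 <= 1 &
  forall x, 0 < x <= x0 -> K <= tau n x.
Proof.
elim: n K => [|n IHn] K.
  exists (1 + `|K|)^-1.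
    by rewrite invr_gt0 invf_le1 ?lerDl ?ltr_pwDl // normr_ge0.
  move=> x /andP[x0 xK]; rewrite tau0E (le_trans (ler_norm K)) //.
  have K0 : 0 < 1 + `|K| by rewrite ltr_pwDl.
  have : 1 + `|K| <= x^-1 by rewrite -[leLHS]invrK lef_pV2 ?posrE ?invr_gt0.
  by lra.
have [x0 x001 hx0] := IHn (expR K); exists x0 => // x xx0.
have x01 : 0 < x <= 1 by move: xx0 x001; lra.
have : K <= ln (tau n x).
  by rewrite -[leLHS]expRK ler_ln ?posrE ?expR_gt0 ?tau_gt0 ?hx0.
by rewrite tauSE; lra.
Qed.

Lemma plog_ratio_small (e : R) : 0 < e ->
  exists2 m, (0 < m)%N & g m%:R^-1 <= e * f m%:R^-1.
Proof.
move=> e0; have [c [s [c0 s0 h]]] := plog_ratio_growth.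
have [x0 /andP[x00 x01] hx0] := tau_unbounded p ((c * e)^-1 `^ s^-1).
pose m := (Num.truncn (x0^-1)).+1.
have m0 : 0 < m%:R :> R by rewrite ltr0n.
have mx0 : m%:R^-1 <= x0.
  rewrite -[leRHS]invrK lef_pV2 ?posrE ?invr_gt0 //.
  have x0i : 0 <= x0^-1 by rewrite invr_ge0 ltW.
  by have /andP[_ /ltW] := truncn_itv x0i.
exists m => //.
have m01 : 0 < (m%:R^-1 : R) <= 1 by rewrite invr_gt0 m0 invf_le1 // ler1n.
(* Comparison with the point [1], where [f], [g] and [tau p] are all equal to [1]. *)
have := h 1 (m%:R^-1) m01 (lexx 1); rewrite !plog1 tau1 !divr1 mulr1.
rewrite ler_pdivlMr ?plog_gt0 // => hm.
have ce : 0 < c * e by rewrite mulr_gt0.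
have : (c * e)^-1 <= tau p m%:R^-1 `^ s.
  have -> : (c * e)^-1 = ((c * e)^-1 `^ s^-1) `^ s.
    by rewrite -powRrM mulVf ?lt0r_neq0 // powRr1 // invr_ge0 ltW.
  apply: ge0_ler_powR; rewrite ?nnegrE ?powR_ge0 ?(ltW s0) ?(ltW (tau_gt0 _ _ m01)) //.
  by apply: hx0; rewrite mx0 andbT; case/andP: m01.
rewrite -[X in X <= _]mul1r ler_pdivrMr // => ht.
have g0 : 0 < g m%:R^-1 by rewrite plog_gt0.
by nra.
Qed.

End Comparison.

(** * Baire category in a countable product of discrete spaces *)

Section Baire.
Context {T : countType} (t0 : T).
Implicit Types (x y : nat -> T) (s t : seq T) (G A : set (nat -> T)) (k n : nat).

Definition cyl s : set (nat -> T) := [set x | mkseq x (size s) = s].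

Lemma cyl_mkseq x k : cyl (mkseq x k) x.
Proof. by rewrite /cyl /= size_mkseq. Qed.

Lemma take_mkseq x k n : (k <= n)%N -> take k (mkseq x n) = mkseq x k.
Proof. by move=> kn; rewrite /mkseq -map_take take_iota (minn_idPl kn). Qed.

Lemma cyl_catl s t x : cyl (s ++ t) x -> cyl s x.
Proof.
rewrite /cyl /= size_cat => h.
by rewrite -(take_mkseq x _ _ (leq_addr (size t) (size s))) h take_size_cat.
Qed.

Lemma cyl_mkseq_cat s x n : cyl s x -> exists t, mkseq x (maxn n (size s)) = s ++ t.
Proof.
move=> xs; exists (drop (size s) (mkseq x (maxn n (size s)))).
by rewrite -[LHS](cat_take_drop (size s)) take_mkseq ?leq_maxr // xs.
Qed.

Lemma cyl_mkseq_le x y k n : (k <= n)%N -> cyl (mkseq x n) y -> mkseq y k = mkseq x k.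
Proof.
by rewrite /cyl /= size_mkseq => kn h; rewrite -(take_mkseq x _ _ kn) -h take_mkseq.
Qed.

Lemma chain_limit (S : nat -> seq T) :
  (forall n, exists2 t, S n.+1 = S n ++ t & (0 < size t)%N) ->
  exists x, forall n, cyl (S n) x.
Proof.
move=> SS; have sz n : (n <= size (S n))%N.
  elim: n => // n IHn; have [t -> t1] := SS n.
  by rewrite size_cat -addn1 leq_add.
have ext m n : (n <= m)%N -> exists t, S m = S n ++ t.
  elim: m => [|m IHm]; first by rewrite leqn0 => /eqP ->; exists [::]; rewrite cats0.
  rewrite leq_eqVlt => /orP[/eqP ->|]; first by exists [::]; rewrite cats0.
  rewrite ltnS => /IHm[t e]; have [t' e' _] := SS m.
  by exists (t ++ t'); rewrite e' e catA.
exists (fun i => nth t0 (S i.+1) i) => n; apply: (@eq_from_nth _ t0).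
  by rewrite size_mkseq.
move=> i; rewrite size_mkseq => iS; rewrite nth_mkseq //.
have [/ext[t ->]|/ltnW/ext[t ->]] := leqP n i.+1; rewrite nth_cat ?iS //.
by rewrite sz.
Qed.

(* [D n] is a dense set of finite sequences: it codes the dense open set of the points that
   extend one of them. *)
Definition comeager G := exists2 D : nat -> seq T -> Prop,
  (forall n s, exists t, D n (s ++ t)) &
  forall x, (forall n, exists k, D n (mkseq x k)) -> G x.

Lemma comeager_sub G G' : G `<=` G' -> comeager G -> comeager G'.
Proof. by move=> GG' [D dD DG]; exists D => // x /DG /GG'. Qed.

Lemma comeager_bigcap {I : countType} (G : I -> set (nat -> T)) :
  (forall i, comeager (G i)) -> comeager (\bigcap_i G i).
Proof.
move=> cG; pose P i (D : nat -> seq T -> Prop) :=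
  (forall n s, exists t, D n (s ++ t)) /\
  forall x, (forall n, exists k, D n (mkseq x k)) -> G i x.
have /choice[D DP] : forall i, exists D, P i D by move=> i; have [D ? ?] := cG i; exists D.
exists (fun n s => if unpickle n is Some (i, j) then D i j s else True).
  move=> n s; case: (unpickle n) => [[i j]|]; last by exists [::].
  exact: (DP i).1.
move=> x hx i _; apply: (DP i).2 => j.
by have := hx (pickle (i, j)); rewrite pickleK.
Qed.

Lemma comeagerI G G' : comeager G -> comeager G' -> comeager (G `&` G').
Proof.
move=> cG cG'; have : comeager (\bigcap_(b in [set: bool]) (if b then G else G')).
  by apply: comeager_bigcap => -[].
by apply: comeager_sub => x h; split; [exact: (h true)|exact: (h false)].
Qed.

Lemma comeager_open (O : seq T -> Prop) : (forall s, exists t, O (s ++ t)) ->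
  comeager [set x | exists k, O (mkseq x k)].
Proof. by move=> dO; exists (fun _ => O) => // x; apply; exact: 0%N. Qed.

Lemma comeager_nonempty G s : comeager G -> exists2 x, G x & cyl s x.
Proof.
move=> [D dD DG]; have /choice[E hE] : forall ns, exists t, D ns.1 (ns.2 ++ t).
  by case=> n u; exact: dD.
pose S := fix S n := if n is m.+1 then rcons (S m ++ E (m, S m)) t0 else s.
have [|x hx] := chain_limit S.
  move=> n; exists (rcons (E (n, S n)) t0); last by rewrite size_rcons.
  by rewrite /= rcons_cat.
exists x; last exact: (hx 0%N).
apply: DG => n; exists (size (S n ++ E (n, S n))).
have := hx n.+1; rewrite /= -cats1 => /cyl_catl ->.
exact: (hE (n, S n)).
Qed.

(** Relative clopenness of [A] in [G], in terms of finite prefixes. *)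
Definition decided G A := forall x, G x ->
  exists k, forall y, G y -> mkseq y k = mkseq x k -> (A x <-> A y).

(* Plays the role of the Baire property for Borel sets; passing to complements is immediate. *)
Definition BP A := exists2 G, comeager G & decided G A.

(** The words whose cylinder is, within [G], included in [A] or disjoint from [A] are dense: either
    a point of [A] provides an extension of the first kind, or the cylinder is already of the
    second. Intersecting [G] with their open set makes [A] clopen. *)
Lemma BP_rel_open G A : comeager G ->
  (forall x, G x -> A x -> exists k, forall y, G y -> mkseq y k = mkseq x k -> A y) ->
  BP A.
Proof.
move=> cG oA; pose O s := (G `&` cyl s `<=` A) \/ (G `&` cyl s `<=` ~` A).
have dO s : exists t, O (s ++ t).
  have [[x [Gx [xs Ax]]]|nA] := pselect (exists x, G x /\ cyl s x /\ A x).
    have [k hk] := oA x Gx Ax; have [t e] := cyl_mkseq_cat s x k xs.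
    exists t; left; rewrite -e => y [Gy]; move/cyl_mkseq_le => h.
    by apply: hk => //; apply: h; rewrite leq_maxl.
  exists [::]; right; rewrite cats0 => y [Gy ys] Ay; apply: nA; by exists y.
exists (G `&` [set x | exists k, O (mkseq x k)]).
  by apply: comeagerI => //; exact: comeager_open.
move=> x [Gx [k Ok]]; exists k => y [Gy _] yx.
have yc : cyl (mkseq x k) y by rewrite /cyl /= size_mkseq.
case: Ok => h; first by split=> _; apply: h; split=> //; exact: cyl_mkseq.
by split=> [/h[]|/h[]] //; split=> //; exact: cyl_mkseq.
Qed.

Lemma BPC A : BP A -> BP (~` A).
Proof.
move=> [G cG dA]; exists G => // x /dA[k hk]; exists k => y Gy yx.
by have := hk y Gy yx; rewrite /setC /=; tauto.
Qed.

Lemma BP_bigcup (A : nat -> set (nat -> T)) :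
  (forall i, BP (A i)) -> BP (\bigcup_i A i).
Proof.
move=> bA; have /choice[G hG] : forall i, exists G, comeager G /\ decided G (A i).
  by move=> i; have [G ? ?] := bA i; exists G.
apply: (@BP_rel_open (\bigcap_i G i)).
  by apply: comeager_bigcap => i; exact: (hG i).1.
move=> x Gx [i _ Ax]; have [k hk] := (hG i).2 x (Gx i I).
exists k => y Gy yx; exists i => //.
by apply/(hk y (Gy i I) yx).
Qed.

Definition subst s x : nat -> T := fun i => if (i < size s)%N then nth t0 s i else x i.

Lemma mkseq_subst s x k : (size s <= k)%N ->
  mkseq (subst s x) k = s ++ drop (size s) (mkseq x k).
Proof.
move=> sk; apply: (@eq_from_nth _ t0); first by rewrite size_cat size_drop !size_mkseq subnKC.
rewrite size_mkseq => i ik; rewrite nth_mkseq // nth_cat /subst; case: ltnP => // si.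
by rewrite nth_drop subnKC // nth_mkseq.
Qed.

(** There are countably many words [s], and overwriting a prefix of fixed length pulls dense open
    sets back to dense open sets. *)
Lemma comeager_subst G : comeager G -> comeager [set x | forall s, G (subst s x)].
Proof.
move=> [D dD DG].
suff : comeager (\bigcap_s [set x | G (subst s x)]) by apply: comeager_sub => x + s; exact.
apply: comeager_bigcap => s.
exists (fun n u => (size s <= size u)%N /\ D n (s ++ drop (size s) u)).
  (* The word is padded so as to cover the part overwritten by [s]; density is then applied to the
     overwritten word. *)
  move=> n u; pose v := u ++ nseq (size s) t0.
  have [t ht] := dD n (s ++ drop (size s) v); exists (nseq (size s) t0 ++ t).
  rewrite catA -/v; split; first by rewrite !size_cat size_nseq -addnA addnCA leq_addr.
  have sv : (size s <= size v)%N by rewrite size_cat size_nseq leq_addl.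
  rewrite drop_cat; case: ltnP => [_|vs]; first by rewrite catA.
  by rewrite (eqP (sv : size s - size v == 0)%N) drop0; move: ht; rewrite drop_oversize ?cats0.
move=> x hx; apply: DG => n; have [k [sk Dk]] := hx n; exists k.
by rewrite mkseq_subst //; move: sk; rewrite size_mkseq.
Qed.

End Baire.

(** * Generic continuity of Borel maps of the cube *)

Section HilbertCube.
Context {R : realType}.
Local Notation I01 := (set_type (`[0%R, 1%R]%classic : set R)).

Lemma cube_coord_continuous (i : nat) :
  continuous (fun z : hilbert_cube R => set_val (z i) : R).
Proof.
move=> z; apply: (@continuous_comp (hilbert_cube R) I01 R (@proj nat (fun=> I01) i) set_val).
  exact: proj_continuous.
exact: initial_continuous.
Qed.

Lemma cube_coord_itv (z : hilbert_cube R) i : 0 <= (set_val (z i) : R) <= 1.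
Proof. by have := set_valP (z i); rewrite /= in_itv. Qed.

Section BorelContinuity.
Context {T : countType} (t0 : T) (v : T -> I01).

Definition embed (x : nat -> T) : hilbert_cube R := fun n => v (x n).

Lemma open_BP (U : set (hilbert_cube R)) : open U -> BP (embed @^-1` U).
Proof.
move=> oU; apply: (@BP_rel_open T setT).
  by exists (fun _ _ => True) => // n s; exists [::].
move=> x _ Ux; apply: contrapT => /forallNP nk.
have /choice[y hy] : forall k, exists y, mkseq y k = mkseq x k /\ ~ U (embed y).
  move=> k; have /existsNP[y /not_implyP[_ /not_implyP[? ?]]] := nk k.
  by exists y.
have yx : (fun k => embed (y k)) @ \oo --> embed x.
  apply/cvg_sup => N V [W] [[Z] oZ <-] ZN ZV.
  apply: (filterS ZV); rewrite nbhs_simpl; exists N.+1 => // k /= Nk.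
  have := congr1 (nth t0 ^~ N) (hy k).1; rewrite !nth_mkseq // /embed => ->.
  exact: ZN.
have : nbhs (embed x) U by apply: open_nbhs_nbhs.
move=> /yx[N _ hN]; apply: (hy N).2.
exact: (hN N (leqnn N)).
Qed.

Lemma borel_BP (B : set (hilbert_cube R)) :
  <<s @open (hilbert_cube R) >> B -> BP (embed @^-1` B).
Proof.
pose P := [set B : set (hilbert_cube R) | BP (embed @^-1` B)].
suff : <<s @open (hilbert_cube R) >> `<=` P by apply.
apply: smallest_sub; last by move=> U; exact: open_BP.
split; first by apply: open_BP; exact: open0.
  by move=> A; rewrite /P /= setTD preimage_setC; exact: BPC.
by move=> A hA; rewrite /P /= preimage_bigcup; exact: BP_bigcup.
Qed.

(** Deciding the countably many rational bounds on the coordinates of the image gives continuity on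
    a comeager set. Keeping only the points all of whose finite modifications lie in that set makes
    it stable under [subst]. *)
Lemma borel_generic_continuity (h : hilbert_cube R -> hilbert_cube R) :
  borel_fun h ->
  exists G, [/\ comeager G, forall x s, G x -> G (subst t0 s x) &
    forall x i (e : R), G x -> 0 < e -> exists k, forall y, G y ->
      mkseq y k = mkseq x k ->
      `|set_val (h (embed x) i) - set_val (h (embed y) i)| < e].
Proof.
move=> bh; pose A (p : nat * nat * nat) :=
  embed @^-1` (h @^-1` [set z : hilbert_cube R | (set_val (z p.1.1) : R) < p.1.2%:R / p.2.+1%:R]).
have /choice[G hG] : forall p, exists G, comeager G /\ decided G (A p).
  move=> p; suff [G ? ?] : BP (A p) by exists G.
  apply: borel_BP; apply: bh; apply: sub_sigma_algebra.
  exact: (open_comp (fun z _ => @cube_coord_continuous p.1.1 z) (@open_lt R _)).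
pose G0 := \bigcap_p G p.
have cG0 : comeager G0 by apply: comeager_bigcap => p; exact: (hG p).1.
exists [set x | forall s, G0 (subst t0 s x)]; split.
- exact: comeager_subst.
- move=> x s Gx s'.
  have -> : subst t0 s' (subst t0 s x) = subst t0 (s' ++ drop (size s') s) x.
    apply/funext => i; rewrite /subst size_cat size_drop nth_cat.
    case: ltnP => si'; first by rewrite (leq_trans si') // leq_addr.
    by rewrite -maxnE leq_max [(i < size s')%N]ltnNge si' /= nth_drop subnKC.
  exact: Gx.
move=> x i e Gx e0.
have sub x' : (forall s, G0 (subst t0 s x')) -> G0 x'.
  move=> /(_ [::]); congr G0; exact/funext.
pose n := Num.truncn e^-1.
have ne : n.+1%:R^-1 < e.
  rewrite -[ltRHS]invrK ltf_pV2 ?posrE ?invr_gt0 ?ltr0n //.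
  exact: truncnS_gt.
(* The decisions for the thresholds [c / n.+1] and [c.+1 / n.+1] trap the coordinate in an interval
   of length less than [e]. *)
pose c := Num.truncn (n.+1%:R * (set_val (h (embed x) i) : R)).
have n0 : 0 < n.+1%:R :> R by rewrite ltr0n.
have /andP[c1 c2] : c%:R <= n.+1%:R * (set_val (h (embed x) i) : R) < c.+1%:R.
  by apply: truncn_itv; rewrite mulr_ge0 // ?ler0n //; case/andP: (cube_coord_itv (h (embed x)) i).
have [k1 hk1] := (hG (i, c, n)).2 x (sub _ Gx _ I).
have [k2 hk2] := (hG (i, c.+1, n)).2 x (sub _ Gx _ I).
exists (maxn k1 k2) => y Gy yx.
have pre k : (k <= maxn k1 k2)%N -> mkseq y k = mkseq x k.
  by move=> kk; rewrite -!(take_mkseq _ _ _ kk) yx.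
have := hk1 y (sub _ Gy _ I) (pre _ (leq_maxl _ _)).
have := hk2 y (sub _ Gy _ I) (pre _ (leq_maxr _ _)).
rewrite /A /= !ltr_pdivlMr // => H2 H1.
have y2 : (set_val (h (embed y) i) : R) * n.+1%:R < c.+1%:R by apply/H2; rewrite mulrC.
have y1 : c%:R <= (set_val (h (embed y) i) : R) * n.+1%:R.
  by rewrite leNgt; apply/negP => /H1; rewrite ltNge mulrC c1.
apply: lt_trans ne; rewrite -[ltRHS]mul1r ltr_pdivlMr // -(ger0_norm (ltW n0)) -normrM.
rewrite mulrBl ltr_norml; move: c1 c2 y1 y2; rewrite -natr1; lra.
Qed.

End BorelContinuity.
End HilbertCube.

(** * Convergence of nonnegative series through partial sums *)

Section BoundedSums.
Context {R : realType}.
Implicit Types (u v : nat -> R) (K e : R).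

Definition bounded_sums u := exists K, forall n, \sum_(0 <= i < n) u i <= K.

Lemma sum_widen u n m n' m' : (forall i, 0 <= u i) -> (n' <= n)%N -> (m <= m')%N ->
  \sum_(n <= i < m) u i <= \sum_(n' <= i < m') u i.
Proof.
move=> u0 nn mm; have [nm|mn] := leqP n m; last first.
  by rewrite big_geq ?(ltnW mn) // sumr_ge0.
rewrite (@big_cat_nat _ _ _ n n' m') ?(leq_trans nm) //= (@big_cat_nat _ _ _ m n m') //=.
by rewrite addrCA lerDl addr_ge0 // sumr_ge0.
Qed.

(** Otherwise infinitely many disjoint blocks would each contribute more than [e]. *)
Lemma bounded_sums_tail u e : (forall i, 0 <= u i) -> bounded_sums u -> 0 < e ->
  exists n, forall m, \sum_(n <= i < m) u i <= e.
Proof.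
move=> u0 [K hK] e0; apply: contrapT => /forallNP nu.
have h k : exists n, e *+ k <= \sum_(0 <= i < n) u i.
  elim: k => [|k [n IHn]]; first by exists 0%N; rewrite mulr0n big_geq.
  have /existsNP[m /negP] := nu n; rewrite -ltNge => hm.
  have [nm|mn] := leqP n m; last by move: hm; rewrite big_geq ?(ltnW mn) // ltNge (ltW e0).
  exists m; rewrite (@big_cat_nat _ _ _ n) //= mulrSr.
  by rewrite lerD // ltW.
have [n hn] := h (Num.truncn (`|K| / e)).+1.
have := le_trans hn (hK n); rewrite -mulr_natr -ler_pdivlMl // [_ * K]mulrC leNgt.
case/negP; apply: (@le_lt_trans _ _ (`|K| / e)); first by rewrite ler_pM2r ?invr_gt0 // ler_norm.
exact: truncnS_gt.
Qed.

Lemma bounded_sums_le u v c : (forall i, 0 <= u i) -> 0 <= c ->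
  (forall i, u i <= c * v i) -> bounded_sums v -> bounded_sums u.
Proof.
move=> u0 c0 uv [K hK]; exists (c * K) => n.
apply: (@le_trans _ _ (\sum_(0 <= i < n) c * v i)); first exact: ler_sum.
by rewrite -mulr_sumr ler_wpM2l.
Qed.

Lemma bounded_sumsD u v : bounded_sums u -> bounded_sums v ->
  bounded_sums (fun i => u i + v i).
Proof.
by move=> [K hK] [L hL]; exists (K + L) => n; rewrite big_split lerD.
Qed.

Lemma sum_pow2_le n : \sum_(0 <= i < n) 2^-1 ^+ i <= 2 :> R.
Proof.
suff -> : \sum_(0 <= i < n) 2^-1 ^+ i = 2 - 2 * 2^-1 ^+ n :> R.
  by rewrite gerBl mulr_ge0 // exprn_ge0.
elim: n => [|n IHn]; first by rewrite big_geq // expr0; lra.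
by rewrite big_nat_recr //= IHn exprS; lra.
Qed.

Lemma bounded_sums_pow2 : bounded_sums (fun i => 2^-1 ^+ i).
Proof. by exists 2 => n; exact: sum_pow2_le. Qed.

End BoundedSums.

(** * Block form of a reduction *)

Section Blocks.
Context {R : realType} {T : countType} (t0 : T).
Variables (Theta : (nat -> T) -> nat -> R) (G : set (nat -> T)) (f : R -> R) (C : R).
Hypothesis Theta01 : forall x i, 0 <= Theta x i <= 1.
Hypothesis G_comeager : comeager G.
Hypothesis G_subst : forall x s, G x -> G (subst t0 s x).
Hypothesis Theta_cont : forall x i (e : R), G x -> 0 < e -> exists k, forall y, G y ->
  mkseq y k = mkseq x k -> `|Theta x i - Theta y i| < e.
Hypothesis f_ge0 : forall x : R, 0 <= x <= 1 -> 0 <= f x.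
Hypothesis C_gt0 : 0 < C.
Hypothesis f_triangle : forall a b c : R, 0 <= a <= 1 -> 0 <= b <= 1 -> 0 <= c <= 1 ->
  f `|a - c| <= C * (f `|a - b| + f `|b - c|).
Hypothesis f_small : forall e : R, 0 < e ->
  exists2 d : R, 0 < d & forall x, 0 <= x <= d -> f x <= e.

Definition gap (x y : nat -> T) i := f `|Theta x i - Theta y i|.

Lemma gap_ge0 x y i : 0 <= gap x y i.
Proof.
apply: f_ge0; rewrite normr_ge0 /=.
by have := Theta01 x i; have := Theta01 y i; rewrite ler_norml; lra.
Qed.

Lemma gapC x y i : gap x y i = gap y x i.
Proof. by rewrite /gap distrC. Qed.

Lemma gap_triangle x y z i : gap x z i <= C * (gap x y i + gap y z i).
Proof. exact: f_triangle. Qed.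

Lemma sum_gap_triangle x y z n m :
  \sum_(n <= i < m) gap x z i <=
  C * (\sum_(n <= i < m) gap x y i + \sum_(n <= i < m) gap y z i).
Proof.
rewrite -big_split mulr_sumr /=; apply: ler_sum => i _; exact: gap_triangle.
Qed.

Lemma gap_continuous x n e : G x -> 0 < e -> exists k, forall y, G y ->
  mkseq y k = mkseq x k -> \sum_(0 <= i < n) gap x y i <= e.
Proof.
move=> Gx; elim: n e => [|n IHn] e e0; first by exists 0%N => y _ _; rewrite big_geq // ltW.
have e20 : 0 < e / 2 by rewrite divr_gt0.
have [k hk] := IHn _ e20; have [d d0 hd] := f_small _ e20.
have [k' hk'] := Theta_cont x n d Gx d0.
exists (maxn k k') => y Gy yx; rewrite big_nat_recr //= (splitr e) lerD //.
  by apply: hk => //; rewrite -!(take_mkseq _ k _ (leq_maxl k k')) yx.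
apply: hd; rewrite normr_ge0 ltW // hk' //.
by rewrite -!(take_mkseq _ k' _ (leq_maxr k k')) yx.
Qed.

(** Continuity at a single point of [G] in the cylinder is enough: two points close to it are close
    to each other by the quasi-triangle inequality, whose constant explains [2 * C]. *)
Lemma head_gap_small u n e t : 0 < e -> exists t', forall x y, G x -> G y ->
  cyl (u ++ t ++ t') x -> cyl (u ++ t ++ t') y -> \sum_(0 <= i < n) gap x y i <= e.
Proof.
move=> e0; have [x0 Gx0 x0u] := comeager_nonempty t0 _ (u ++ t) G_comeager.
have e'0 : 0 < e / (2 * C) by rewrite divr_gt0 // mulr_gt0.
have [k hk] := gap_continuous x0 n _ Gx0 e'0.
have [t' ht'] := cyl_mkseq_cat _ _ k x0u; exists t' => x y Gx Gy.
rewrite catA -ht' => /(cyl_mkseq_le _ _ k) -/(_ (leq_maxl _ _)) xk.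
move=> /(cyl_mkseq_le _ _ k) -/(_ (leq_maxl _ _)) yk.
apply: le_trans (sum_gap_triangle x x0 y _ _) _.
rewrite (eq_bigr (gap x0 x)) => [|i _]; last exact: gapC.
rewrite -ler_pdivlMl // (le_trans (lerD (hk _ Gx xk) (hk _ Gy yk))) //.
by rewrite invfM; lra.
Qed.

Hypothesis finite_change : forall x s, G x -> bounded_sums (gap x (subst t0 s x)).

Lemma cyl_subst u u' s x : size u = size u' -> cyl (u ++ s) x ->
  cyl (u' ++ s) (subst t0 u' x).
Proof.
rewrite /cyl /= !size_cat => uu' h; rewrite mkseq_subst ?leq_addr // -uu' h.
by rewrite drop_size_cat.
Qed.

(** If no extension and no [n] worked, the points with some sum from [n] on above [e'] would
    contain, for every [n], a dense relatively open part of the cylinder of [u ++ t] in [G]. A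
    generic point there would have all its tails large, against [finite_change]. *)
Lemma tail_gap_small u u' e t : size u = size u' -> 0 < e ->
  exists t' n, forall x, G x -> cyl (u ++ t ++ t') x ->
  forall m, \sum_(n <= i < m) gap x (subst t0 u' x) i <= e.
Proof.
move=> uu' e0; apply: contrapT => nex.
have {}nex t' n : exists x m, [/\ G x, cyl (u ++ t ++ t') x &
    e < \sum_(n <= i < m) gap x (subst t0 u' x) i].
  apply: contrapT => h; apply: nex; exists t', n => x Gx xc m.
  by rewrite leNgt; apply/negP => hm; apply: h; exists x, m.
(* Going from a bad point [x] to a nearby [y] uses the quasi-triangle inequality twice: the errors
   [e2] absorb half of [e], and [C ^+ 2] times the sum at [y] must exceed the other half. *)
pose e' := e / (2 * C ^+ 2).
have e'0 : 0 < e' by rewrite divr_gt0 // mulr_gt0 // exprn_gt0.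
pose l := size (u ++ t).
(* Long words that do not extend [u ++ t] satisfy the condition vacuously, which makes [O n] dense
   everywhere and not only in that cylinder. *)
pose O n s := (l <= size s)%N /\ (take l s = u ++ t -> forall y, G y -> cyl s y ->
  exists m, e' < \sum_(n <= i < m) gap y (subst t0 u' y) i).
have dO n s : exists s', O n (s ++ s').
  pose s1 := s ++ nseq l t0.
  have ls1 : (l <= size s1)%N by rewrite size_cat size_nseq leq_addl.
  have [ts|nts] := eqVneq (take l s1) (u ++ t); last first.
    by exists (nseq l t0); split => // h; move: nts; rewrite -/s1 h eqxx.
  have [x [m [Gx xs1 xm]]] := nex (drop l s1) n.
  rewrite catA -ts cat_take_drop in xs1.
  pose e2 := e / (2 * (C * (1 + C))).
  have C10 : 0 < 1 + C by rewrite addr_gt0.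
  have e20 : 0 < e2 by rewrite divr_gt0 // !mulr_gt0.
  have [k1 hk1] := gap_continuous x m e2 Gx e20.
  have [k2 hk2] := gap_continuous (subst t0 u' x) m e2 (G_subst _ u' Gx) e20.
  pose k := maxn (maxn k1 k2) (size s1).
  have k1k : (k1 <= k)%N by rewrite !leq_max leqnn.
  have k2k : (k2 <= k)%N by rewrite !leq_max leqnn orbT.
  have [s' hs'] := cyl_mkseq_cat _ _ (maxn k1 k2) xs1.
  exists (nseq l t0 ++ s'); rewrite catA -/s1 -hs' -/k; split.
    by rewrite size_mkseq (leq_trans ls1) // leq_maxr.
  move=> _ y Gy yk; exists m.
  have yx : mkseq y k = mkseq x k by exact: cyl_mkseq_le yk.
  have le_sub z z' : \sum_(n <= i < m) gap z z' i <= \sum_(0 <= i < m) gap z z' i.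
    by apply: sum_widen => // i; exact: gap_ge0.
  have h1 : \sum_(n <= i < m) gap x y i <= e2.
    apply: le_trans (le_sub _ _) _; apply: hk1 => //.
    by rewrite -!(take_mkseq _ _ _ k1k) yx.
  have h2 : \sum_(n <= i < m) gap (subst t0 u' x) (subst t0 u' y) i <= e2.
    apply: le_trans (le_sub _ _) _; apply: hk2; first exact: G_subst.
    have su'k : (size u' <= k)%N.
      rewrite -uu' (leq_trans _ (leq_trans ls1 (leq_maxr _ _))) //.
      by rewrite /l size_cat leq_addr.
    by rewrite -!(take_mkseq _ _ _ k2k) !mkseq_subst // yx.
  have := sum_gap_triangle x y (subst t0 u' x) n m.
  have := sum_gap_triangle y (subst t0 u' y) (subst t0 u' x) n m.
  under [X in C * (_ + X)]eq_bigr do rewrite gapC.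
  set S := \sum_(n <= i < m) gap y (subst t0 u' y) i.
  move=> h3 h4.
  have h5 : e < C * (e2 + C * (S + e2)).
    apply: lt_le_trans xm _; apply: le_trans h4 _.
    by rewrite ler_pM2l // lerD // (le_trans h3) // ler_pM2l // lerD2l.
  rewrite /e' ltr_pdivrMr ?mulr_gt0 ?exprn_gt0 //.
  have : e2 * (2 * (C * (1 + C))) = e by rewrite divfK // !mulf_neq0 ?gt_eqF.
  by nra.
have [y [Gy Oy] yt] : exists2 y,
    (G `&` \bigcap_n [set x | exists k, O n (mkseq x k)]) y & cyl (u ++ t) y.
  apply: comeager_nonempty => //; apply: comeagerI => //.
  by apply: comeager_bigcap => n; exact: comeager_open.
have [n hn] := bounded_sums_tail _ _ (gap_ge0 y (subst t0 u' y)) (finite_change y u' Gy) e'0.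
have [k [lk]] := Oy n I; rewrite size_mkseq in lk.
rewrite take_mkseq // => /(_ yt y Gy (cyl_mkseq _ _))[m].
by rewrite ltNge hn.
Qed.

Lemma finite_dense (I : eqType) (s : seq I) (P : I -> seq T -> Prop) :
  (forall i t t', P i t -> P i (t ++ t')) ->
  (forall i, i \in s -> forall t, exists t', P i (t ++ t')) ->
  forall t, exists t', forall i, i \in s -> P i (t ++ t').
Proof.
move=> mP; elim: s => [|i s IHs] dP t; first by exists [::].
have [|t1 h1] := IHs _ t; first by move=> j js; apply: dP; rewrite inE js orbT.
have [t2 h2] := dP i (mem_head _ _) (t ++ t1).
exists (t1 ++ t2) => j; rewrite catA inE => /orP[/eqP ->//|/h1].
exact: mP.
Qed.

Lemma finite_bound (I : eqType) (s : seq I) (P : I -> nat -> Prop) :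
  (forall i n m, (n <= m)%N -> P i n -> P i m) ->
  (forall i, i \in s -> exists n, P i n) ->
  exists n, forall i, i \in s -> P i n.
Proof.
move=> mP; elim: s => [|i s IHs] eP; first by exists 0%N.
have [|n hn] := IHs; first by move=> j js; apply: eP; rewrite inE js orbT.
have [m hm] := eP i (mem_head _ _).
exists (maxn n m) => j; rewrite inE => /orP[/eqP ->|/hn].
  by apply: mP hm; rewrite leq_maxr.
by apply: mP; rewrite leq_maxl.
Qed.

Section Construction.
Variables (D : nat -> seq T -> Prop).
Hypothesis D_dense : forall n s, exists t, D n (s ++ t).
Hypothesis D_sub : forall x, (forall n, exists k, D n (mkseq x k)) -> G x.

(** The filler [t] has three duties: it meets the [n]-th dense set, so that limits lie in [G];
    beyond [N] the choice of the prefix hardly affects the image; before [N] the image is nearly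
    determined by the word read so far. *)
Definition good_block n (N0 : nat) (L : seq (seq T)) (t : seq T) (N : nat) :=
  (N0 < N)%N /\ forall u, u \in L -> [/\
    exists2 k, (k <= size (u ++ t))%N & D n (take k (u ++ t)),
    forall u', u' \in L -> forall x, G x -> cyl (u ++ t) x ->
      forall m, \sum_(N <= i < m) gap x (subst t0 u' x) i <= 2^-1 ^+ n &
    forall x y, G x -> G y -> cyl (u ++ t) x -> cyl (u ++ t) y ->
      \sum_(0 <= i < N) gap x y i <= 2^-1 ^+ n].

(** The order matters: the tail condition yields [N], and only then can the head condition, which
    depends on [N], be met. The earlier conditions survive an extension of [t] and an increase of
    the bound. *)
Lemma good_block_exists n N0 L l : (forall u, u \in L -> size u = l) ->
  exists t N, good_block n N0 L t N.
Proof.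
move=> Ll; have e0 : 0 < 2^-1 ^+ n :> R by rewrite exprn_gt0.
pose P1 u t := exists2 k, (k <= size (u ++ t))%N & D n (take k (u ++ t)).
have P1_mono u t t' : P1 u t -> P1 u (t ++ t').
  move=> [k ku Dk]; exists k; first by rewrite catA size_cat (leq_trans ku) // leq_addr.
  by rewrite catA takel_cat.
pose P2 (p : seq T * seq T) t := exists N, forall x, G x -> cyl (p.1 ++ t) x ->
  forall m, \sum_(N <= i < m) gap x (subst t0 p.2 x) i <= 2^-1 ^+ n.
have P2_mono p t t' : P2 p t -> P2 p (t ++ t').
  by move=> [N hN]; exists N => x Gx; rewrite catA => /cyl_catl; exact: hN.
have [|t1 ht1] := @finite_dense _ L P1 P1_mono _ [::].
  move=> u _ t; have [t' ht'] := D_dense n (u ++ t); exists t'.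
  by exists (size (u ++ t ++ t')); rewrite // catA take_size.
have [|t2 ht2] := @finite_dense _ [seq (u, u') | u <- L, u' <- L] P2 P2_mono _ t1.
  move=> _ /allpairsP[[u u'] [/= uL u'L ->]] t.
  have [t' [N hN]] := @tail_gap_small u u' _ t (etrans (Ll _ uL) (esym (Ll _ u'L))) e0.
  by exists t', N.
have [|N hN] := @finite_bound _ [seq (u, u') | u <- L, u' <- L]
  (fun p N => forall x, G x -> cyl (p.1 ++ t1 ++ t2) x ->
     forall m, \sum_(N <= i < m) gap x (subst t0 p.2 x) i <= 2^-1 ^+ n) _ ht2.
  move=> p k m km h x Gx xc m'; apply: le_trans (h x Gx xc m').
  by apply: sum_widen => // i; exact: gap_ge0.
pose N' := maxn N N0.+1.
pose P3 u t := forall x y, G x -> G y -> cyl (u ++ t) x -> cyl (u ++ t) y ->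
      \sum_(0 <= i < N') gap x y i <= 2^-1 ^+ n.
have P3_mono u t t' : P3 u t -> P3 u (t ++ t').
  by move=> h x y Gx Gy; rewrite catA => /cyl_catl xc /cyl_catl yc; exact: h.
have [|t3 ht3] := @finite_dense _ L P3 P3_mono _ (t1 ++ t2).
  by move=> u _ t; have [t' ht'] := @head_gap_small u N' _ t e0; exists t'.
exists ((t1 ++ t2) ++ t3), N'; split; first exact: leq_maxr.
move=> u uL; split; [|move=> u' u'L x Gx xc m|exact: ht3].
- by rewrite -catA; apply: P1_mono; exact: ht1.
- apply: (@le_trans _ _ (\sum_(N <= i < m) gap x (subst t0 u' x) i)).
    by apply: sum_widen => //; [move=> i; exact: gap_ge0 | rewrite leq_maxl].
  apply: (hN (u, u')) => //=; first by apply/allpairsP; exists (u, u').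
  by rewrite catA in xc; exact: cyl_catl xc.
Qed.

End Construction.

Lemma sum_zip_diag (g : T -> T -> R) (s : seq T) : (forall v, g v v = 0) ->
  \sum_(p <- zip s s) g p.1 p.2 = 0.
Proof. by move=> g0; elim: s => [|v s IHs]; rewrite ?big_nil //= big_cons g0 IHs addr0. Qed.

Lemma sum_zip_mkseq (g : T -> T -> R) x y n :
  \sum_(p <- zip (mkseq x n) (mkseq y n)) g p.1 p.2 = \sum_(0 <= i < n) g (x i) (y i).
Proof.
rewrite /mkseq /index_iota subn0; elim: (iota 0 n) => [|i s IHs].
  by rewrite !big_nil.
by rewrite /= !big_cons IHs.
Qed.

(* [y a] is [t_0 a_0 t_1 a_1 ...] for suitable filler words [t_n]; on the coordinates in
   [[N n, N n.+1[] the image of [y a] depends, up to a summable error, on [a n] only. *)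
Lemma block_form (V : nat -> seq T) (dflt : nat -> T) : (forall n, dflt n \in V n) ->
  exists (y : (nat -> T) -> nat -> T) (N : nat -> nat) (z : nat -> T -> nat -> T),
  [/\ forall n, (N n < N n.+1)%N,
      forall a b (g : T -> T -> R), (forall v, g v v = 0) -> (forall v w, 0 <= g v w) ->
        bounded_sums (fun i => g (y a i) (y b i)) <->
        bounded_sums (fun n => g (a n) (b n)) &
      forall a, (forall n, a n \in V n) -> forall n,
        \sum_(N n <= i < N n.+1) gap (y a) (z n (a n)) i <= 2 * C * 2^-1 ^+ n].
Proof.
move=> dV; have [D D_dense D_sub] := G_comeager.
have [F hF] : exists F : nat * nat * seq (seq T) -> seq T * nat, forall n N0 L l,
    (forall u, u \in L -> size u = l) ->
    good_block D n N0 L (F (n, N0, L)).1 (F (n, N0, L)).2.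
  have /choice[F hF] : forall p : nat * nat * seq (seq T), exists q : seq T * nat,
      forall l, (forall u, u \in p.2 -> size u = l) -> good_block D p.1.1 p.1.2 p.2 q.1 q.2.
    move=> [[n N0] L] /=; have [[l hl]|nl] := pselect (exists l, forall u, u \in L -> size u = l).
      have [t [N h]] := @good_block_exists D D_dense n N0 L l hl.
      by exists (t, N).
    by exists ([::], 0%N) => l hl; exfalso; apply: nl; exists l.
  by exists F => n N0 L l; exact: (hF (n, N0, L) l).
(* [(st n).1] lists all prefixes possible after [n] letters, which have equal length, and [(st n).2]
   is the last bound chosen; the filler [t n] thus depends on [n] alone. *)
pose st := fix st n := if n is m.+1 then
    let q := F (m, (st m).2, (st m).1) in
    ([seq u ++ q.1 ++ [:: v] | u <- (st m).1, v <- V m], q.2)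
  else ([:: [::]], 0%N).
pose t n := (F (n, (st n).2, (st n).1)).1.
pose N n := (st n.+1).2.
pose Q := fix Q (a : nat -> T) n := if n is m.+1 then Q a m ++ t m ++ [:: a m] else [::].
pose l := fix l n := if n is m.+1 then (l m + (size (t m)).+1)%N else 0%N.
have stl n u : u \in (st n).1 -> size u = l n.
  elim: n u => [|n IHn] u /=; first by rewrite inE => /eqP ->.
  move=> /allpairsP[[u' v] [/= /IHn u'l _ ->]].
  by rewrite !size_cat /= u'l addn1.
have stgood n : good_block D n (st n).2 (st n).1 (t n) (N n) by apply: hF (stl n).
have Ql a n : size (Q a n) = l n by elim: n => //= n IHn; rewrite !size_cat IHn addn1.
have Qst a n : (forall i, a i \in V i) -> Q a n \in (st n).1.
  move=> aV; elim: n => [|n IHn] /=; first by rewrite inE.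
  by apply/allpairsP; exists (Q a n, a n); split => //=; exact: aV.
have /choice[y hy] : forall a, exists x, forall n, cyl (Q a n) x.
  move=> a; apply: (@chain_limit _ t0) => n; exists (t n ++ [:: a n]) => //.
  by rewrite size_cat addn1.
have yt a n : cyl (Q a n ++ t n) (y a).
  by have := hy a n.+1; rewrite /= catA => /cyl_catl.
have yG a : (forall i, a i \in V i) -> G (y a).
  move=> aV; apply: D_sub => n; have [_ /(_ _ (Qst a n aV))[[k kQ Dk] _ _]] := stgood n.
  by exists k; rewrite -(take_mkseq _ _ _ kQ) yt.
pose e n v : nat -> T := fun i => if i == n then v else dflt i.
exists y, N, (fun n v => y (e n v)); split.
- by move=> n; have [] := stgood n.+1.
- move=> a b g g0 gge0.
  (* The fillers are common to [y a] and [y b], so only the letters [a j] and [b j] contribute. *)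
  have sumE n : \sum_(0 <= i < l n) g (y a i) (y b i) = \sum_(0 <= j < n) g (a j) (b j).
    rewrite -sum_zip_mkseq; have := hy a n; have := hy b n.
    rewrite /cyl /= !Ql => -> ->; elim: n => [|n IHn]; first by rewrite big_nil big_geq.
    rewrite big_nat_recr //= -IHn !catA zip_cat ?size_cat ?Ql // big_cat /=.
    by rewrite big_seq1 zip_cat ?Ql // big_cat /= sum_zip_diag // addr0.
  have nl n : (n <= l n)%N by elim: n => //= n IHn; rewrite addnS ltnS (leq_trans IHn) // leq_addr.
  split=> -[K hK]; exists K => n; first by rewrite -sumE.
  by apply: le_trans (hK n); rewrite -sumE; exact: sum_widen.
(* [w] has the default letters before block [n] and those of [a] afterwards. It is close to [y a]
   from [N n] on by the tail condition of stage [n], and to [y (e n (a n))] before [N n.+1] by the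
   head condition of stage [n.+1]. *)
- move=> a aV n; pose w := subst t0 (Q dflt n) (y a).
  have eV : forall i, e n (a n) i \in V i by move=> i; rewrite /e; case: eqP => [->|_].
  have Qe : Q (e n (a n)) n.+1 = Q dflt n ++ t n ++ [:: a n].
    rewrite /= {2}/e eqxx; congr (_ ++ _).
    have : forall m, (m <= n)%N -> Q (e n (a n)) m = Q dflt m.
      elim=> //= m IHm mn; rewrite IHm ?(ltnW mn) // /e ifN //.
      by rewrite neq_ltn mn.
    exact.
  have Gw : G w by apply: G_subst; exact: yG.
  have wc : cyl (Q (e n (a n)) n.+1 ++ t n.+1) w.
    rewrite Qe -catA; apply: (@cyl_subst (Q a n)); first by rewrite !Ql.
    by have := yt a n.+1; rewrite /= -catA.
  have [_ /(_ _ (Qst a n aV))[_ /(_ _ (Qst dflt n dV)) h1 _]] := stgood n.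
  have [_ /(_ _ (Qst (e n (a n)) n.+1 eV))[_ _ h2]] := stgood n.+1.
  apply: le_trans (sum_gap_triangle (y a) w (y (e n (a n))) _ _) _.
  rewrite [2 * C]mulrC -mulrA ler_pM2l // [2 * _]mulrDl mul1r lerD //.
    by apply: h1; [exact: yG | exact: yt].
  apply: (@le_trans _ _ (2^-1 ^+ n.+1)); last first.
    by rewrite exprS ger_pMl ?exprn_gt0 // invf_le1 // ler1n.
  apply: le_trans (h2 w (y (e n (a n))) Gw (yG _ eV) wc (yt _ _)).
  by apply: sum_widen => // i; exact: gap_ge0.
Qed.

End Blocks.

(** * Non-reducibility *)

Section MoreBoundedSums.
Context {R : realType}.
Implicit Types (u v : nat -> R).

Lemma nneseries_lt_pinfty u : (forall i, 0 <= u i) ->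
  (\sum_(0 <= n <oo) (u n)%:E < +oo)%E <-> bounded_sums u.
Proof.
move=> u0; have u0E i : (0 <= (u i)%:E)%E by rewrite lee_fin.
split=> [h|[K hK]].
  exists (fine (\sum_(0 <= n <oo) (u n)%:E)%E) => n.
  rewrite -lee_fin fineK ?ge0_fin_numE ?nneseries_ge0 // -sumEFin.
  exact: nneseries_lim_ge.
apply: (@le_lt_trans _ _ K%:E); last exact: ltry.
apply: lime_le; first exact: is_cvg_nneseries.
by apply: nearW => n; rewrite sumEFin lee_fin.
Qed.

Lemma Erel_bounded_sums (f : R -> R) (x y : hilbert_cube R) :
  (forall t, 0 <= t <= 1 -> 0 <= f t) ->
  Erel f x y <-> bounded_sums (fun i => f `|set_val (x i) - set_val (y i)|).
Proof.
move=> f0; rewrite /Erel.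
under eq_eseriesr do rewrite distrC.
apply: nneseries_lt_pinfty => i; apply: f0; rewrite normr_ge0 /=.
by have := cube_coord_itv x i; have := cube_coord_itv y i; rewrite ler_norml; lra.
Qed.

Lemma bounded_sums_finite u n : (forall i, 0 <= u i) ->
  (forall i, (n <= i)%N -> u i = 0) -> bounded_sums u.
Proof.
move=> u0 un; exists (\sum_(0 <= i < n) u i) => m.
have [mn|nm] := leqP m n; first exact: sum_widen.
rewrite (@big_cat_nat _ _ _ n) ?(ltnW nm) //= [X in _ + X]big1_seq ?addr0 //.
by move=> i /andP[_]; rewrite mem_index_iota => /andP[ni _]; exact: un.
Qed.

Lemma bounded_sums_blocks u (N : nat -> nat) : (forall i, 0 <= u i) ->
  (forall n, (N n < N n.+1)%N) ->
  bounded_sums u <-> bounded_sums (fun n => \sum_(N n <= i < N n.+1) u i).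
Proof.
move=> u0 Nlt; have blocks n : \sum_(0 <= j < n) \sum_(N j <= i < N j.+1) u i =
    \sum_(N 0%N <= i < N n) u i.
  elim: n => [|n IHn]; first by rewrite !big_geq.
  rewrite big_nat_recr //= IHn -big_cat_nat //=; last exact: ltnW.
  by elim: n {IHn} => // n /leq_trans; apply; exact: ltnW.
have Nge n : (n <= N n)%N by elim: n => // n IHn; exact: leq_ltn_trans (Nlt n).
split=> -[K hK].
  by exists K => n; rewrite blocks; apply: le_trans (hK (N n)); exact: sum_widen.
exists (\sum_(0 <= i < N 0%N) u i + K) => n.
apply: (@le_trans _ _ (\sum_(0 <= i < N n) u i)); first exact: sum_widen.
have N0n : (N 0 <= N n)%N by elim: n => // n /leq_trans; apply; exact: ltnW.
by rewrite (@big_cat_nat _ _ _ (N 0%N)) //= lerD2l -blocks.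
Qed.

End MoreBoundedSums.

(** * Separating a convergent series from a divergent one *)

Section Greedy.
Context {R : realType}.
Variables f g : nat -> R.
Hypothesis f_gt0 : forall m, (0 < m)%N -> 0 < f m <= 1.
Hypothesis g_small : forall e : R, 0 < e -> exists2 m, (0 < m)%N & g m <= e * f m.

(* The next index is chosen according to the integer part of the sum of [f] so far. *)
Lemma separating_sequence : exists m : nat -> nat, [/\ forall n, (0 < m n)%N,
  bounded_sums (g \o m) & ~ bounded_sums (f \o m)].
Proof.
(* The denominator dominates [(1 + F n) * (1 + F n.+1)] as long as the sum [F n] has integer part
   [k], so the terms of [g] are bounded by the increments of [- (1 + F n)^-1]. *)
have /choice[M hM] : forall k : nat, exists m, (0 < m)%N /\
    g m <= (k.+2%:R * k.+3%:R)^-1 * f m.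
  move=> k; have [|m m0 hm] := g_small (k.+2%:R * k.+3%:R)^-1; last by exists m.
  by rewrite invr_gt0 mulr_gt0 // ltr0n.
pose F := fix F n : R := if n is k.+1 then F k + f (M (Num.truncn (F k))) else 0.
pose m n := M (Num.truncn (F n)).
have m0 n : (0 < m n)%N := (hM _).1.
have fm n : 0 < f (m n) <= 1 := f_gt0 _ (m0 n).
have FE n : \sum_(0 <= i < n) f (m i) = F n.
  by elim: n => [|n IHn]; [rewrite big_geq | rewrite big_nat_recr //= IHn].
have F0 n : 0 <= F n by rewrite -FE sumr_ge0 // => i _; case/andP: (fm i) => /ltW.
exists m; split=> //.
  exists 1 => n; apply: (@le_trans _ _ (1 - (1 + F n)^-1)); last first.
    by rewrite gerBl invr_ge0 addr_ge0.
  elim: n => [|n IHn]; first by rewrite big_geq //= addr0 invr1 subrr.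
  rewrite big_nat_recr //=; apply: le_trans (lerD IHn (hM _).2) _.
  rewrite -/(m n); have /andP[f0 f1] := fm n; set k := Num.truncn (F n).
  have Fk : F n < k.+1%:R by exact: truncnS_gt.
  have Fn0 := F0 n; set p := (k.+2%:R * k.+3%:R)^-1.
  have hp : p <= ((1 + F n) * (1 + (F n + f (m n))))^-1.
    rewrite lef_pV2 ?posrE ?mulr_gt0 ?ltr0n //; try lra.
    by apply: ler_pM; move: Fk; rewrite -!natr1; lra.
  suff : p * f (m n) <= (1 + F n)^-1 - (1 + (F n + f (m n)))^-1 by lra.
  have -> : (1 + F n)^-1 - (1 + (F n + f (m n)))^-1 =
      ((1 + F n) * (1 + (F n + f (m n))))^-1 * f (m n).
    by field; apply/andP; split; apply: lt0r_neq0; lra.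
  by rewrite ler_pM2r.
move=> [K hK].
(* If [F] stays below [K], only finitely many [M k] occur and the terms of [f] are bounded below by
   a positive constant. *)
have [c c0 hc] : exists2 c : R, 0 < c & forall k, (k <= Num.truncn K)%N -> c <= f (M k).
  elim: (Num.truncn K) => [|B [c c0 hc]].
    exists (f (M 0%N)); first by have /andP[] := f_gt0 _ (hM 0%N).1.
    by move=> k; rewrite leqn0 => /eqP ->.
  exists (Num.min c (f (M B.+1))).
    by rewrite lt_min c0; have /andP[->] := f_gt0 _ (hM B.+1).1.
  move=> k; rewrite leq_eqVlt => /orP[/eqP ->|kB]; rewrite ge_min ?lexx ?orbT //.
  by rewrite hc.
have FK n : F n <= K by rewrite -FE; exact: hK.
have cF n : c *+ n <= F n.
  elim: n => // n IHn /=; rewrite mulrSr lerD // hc //.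
  exact/le_truncn/FK.
have K0 : 0 <= K := le_trans (F0 0%N) (FK 0%N).
have := le_trans (cF (Num.truncn (K / c)).+1) (FK _).
rewrite -mulr_natr -ler_pdivlMl // [_ * K]mulrC leNgt => /negP; apply.
exact: truncnS_gt.
Qed.

End Greedy.

(** * Non-reducibility from the cost of chains *)

Section NonReducibility.
Context {R : realType}.

Lemma grid_itv (p : nat * nat) :
  (minn p.1 p.2)%:R / p.2%:R \in (`[0%R, 1%R]%classic : set R).
Proof.
rewrite inE /= in_itv /= divr_ge0 //=; case: p => a [|m] /=; first by rewrite invr0 mulr0.
by rewrite ler_pdivrMr ?ltr0n // mul1r ler_nat geq_minr.
Qed.

(** The minimum keeps every letter in [[0,1]], so that one countable alphabet serves all the
    grids. *)
Definition grid (p : nat * nat) : set_type (`[0%R, 1%R]%classic : set R) :=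
  SigSub (grid_itv p).

Lemma grid_dist a b m : (0 < m)%N -> (a <= m)%N -> (b <= m)%N ->
  `|set_val (grid (a, m)) - set_val (grid (b, m))| = `|a%:R - b%:R| / m%:R :> R.
Proof.
move=> m0 am bm; rewrite /= /set_val /= (minn_idPl am) (minn_idPl bm) -mulrBl normrM.
by congr (_ * _); rewrite ger0_norm // invr_ge0.
Qed.

Variables (f g : R -> R) (C c : R) (m : nat -> nat).
Hypothesis f_ge0 : forall x : R, 0 <= x <= 1 -> 0 <= f x.
Hypothesis f0 : f 0 = 0.
Hypothesis C_gt0 : 0 < C.
Hypothesis f_triangle : forall a b c : R, 0 <= a <= 1 -> 0 <= b <= 1 -> 0 <= c <= 1 ->
  f `|a - c| <= C * (f `|a - b| + f `|b - c|).
Hypothesis f_small : forall e : R, 0 < e ->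
  exists2 d : R, 0 < d & forall x, 0 <= x <= d -> f x <= e.
Hypothesis c_gt0 : 0 < c.
Hypothesis f_chain : forall k (z : nat -> R), (0 < k)%N -> (forall i, 0 <= z i <= 1) ->
  c * k%:R * f k%:R^-1 * f `|z 0%N - z k| <= \sum_(0 <= i < k) f `|z i - z i.+1|.
Hypothesis g_ge0 : forall x : R, 0 <= x <= 1 -> 0 <= g x.
Hypothesis g0 : g 0 = 0.
Hypothesis g1 : 0 < g 1.
Hypothesis m_gt0 : forall n, (0 < m n)%N.
Hypothesis g_summable : bounded_sums (fun n => g (m n)%:R^-1).
Hypothesis f_not_summable : ~ bounded_sums (fun n => f (m n)%:R^-1).

Lemma not_borel_reducible : ~ borel_reducible (Erel g) (Erel f).
Proof.
move=> [h /(borel_generic_continuity (0, 0)%N grid)[G [G_com G_subst G_cont]] hred].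
have minv01 n : 0 <= ((m n)%:R^-1 : R) <= 1.
  by rewrite invr_ge0 ler0n invf_le1 ?ltr0n ?ler1n m_gt0.
pose Theta x i : R := set_val (h (embed grid x) i).
have Theta01 x i : 0 <= Theta x i <= 1 by exact: cube_coord_itv.
pose gd (p q : nat * nat) : R := g `|set_val (grid p) - set_val (grid q)|.
have gd_ge0 p q : 0 <= gd p q.
  apply: g_ge0; rewrite normr_ge0 /=.
  have := cube_coord_itv (fun=> grid p) 0%N; have := cube_coord_itv (fun=> grid q) 0%N.
  by rewrite ler_norml; lra.
have gd0 p : gd p p = 0 by rewrite /gd subrr normr0.
pose gp := gap Theta f.
have gp_ge0 := gap_ge0 Theta f Theta01 f_ge0.
have red x y : bounded_sums (fun i => gd (x i) (y i)) <-> bounded_sums (gp x y).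
  have := hred (embed grid x) (embed grid y).
  by rewrite !Erel_bounded_sums.
have fin x s : G x -> bounded_sums (gp x (subst (0, 0)%N s x)).
  move=> _; apply/red; apply: (@bounded_sums_finite _ _ (size s)) => // i si.
  by rewrite /subst ltnNge si.
pose V n := [seq (i, m n) | i <- iota 0 (m n).+1].
have inV n i : (i <= m n)%N -> (i, m n) \in V n.
  by move=> im; apply: map_f; rewrite mem_iota.
have [y [N [z [Nlt yg yz]]]] := block_form (0, 0)%N Theta G f C Theta01 G_com G_subst
  G_cont f_ge0 C_gt0 f_triangle f_small fin V (fun n => (0%N, m n)) (fun n => inV n 0%N (leq0n _)).
pose d n v w := \sum_(N n <= i < N n.+1) gp (z n v) (z n w) i.
have d_ge0 n v w : 0 <= d n v w by apply: sumr_ge0 => i _; exact: gp_ge0.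
have dd n v : d n v v = 0 by rewrite /d big1 // => i _; rewrite /gp /gap subrr normr0.
have triple x1 x2 x3 x4 n k : \sum_(n <= i < k) gp x1 x4 i <=
    C * (\sum_(n <= i < k) gp x1 x2 i +
         C * (\sum_(n <= i < k) gp x2 x3 i + \sum_(n <= i < k) gp x3 x4 i)).
  apply: le_trans (sum_gap_triangle Theta f C Theta01 f_triangle x1 x2 x4 n k) _.
  rewrite ler_pM2l // lerD2l.
  exact: (sum_gap_triangle Theta f C Theta01 f_triangle).
have yz' a : (forall n, a n \in V n) -> forall n,
    \sum_(N n <= i < N n.+1) gp (z n (a n)) (y a) i <= 2 * C * 2^-1 ^+ n.
  move=> aV n; rewrite (eq_bigr (gp (y a) (z n (a n)))) => [|i _]; first exact: yz.
  exact: gapC.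
(* From here on only the block costs [d n] matter: replacing [y a] by [z n (a n)] adds errors of
   order [2^-1 ^+ n], which are summable. *)
have block_red a b : (forall n, a n \in V n) -> (forall n, b n \in V n) ->
    bounded_sums (fun n => gd (a n) (b n)) <-> bounded_sums (fun n => d n (a n) (b n)).
  move=> aV bV; rewrite -(yg a b gd gd0 gd_ge0) red (bounded_sums_blocks _ N) //.
  pose K := C * (2 * C) + C * C * (2 * C).
  have C0 := ltW C_gt0; have K0 : 0 <= K by rewrite addr_ge0 ?mulr_ge0.
  have C20 : 0 < C * C by rewrite mulr_gt0.
  split=> hb.
    apply: (@bounded_sums_le _ _
      (fun n => K * 2^-1 ^+ n + C * C * \sum_(N n <= i < N n.+1) gp (y a) (y b) i) 1) => // [n|].
      apply: le_trans (triple _ (y a) (y b) _ _ _) _; rewrite mul1r.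
      have := yz' a aV n; have := yz b bV n; rewrite -/gp.
      move: (\sum_(_ <= i < _) gp (y b) _ i) => s1; move: (\sum_(_ <= i < _) gp _ (y a) i) => s2.
      move: (\sum_(_ <= i < _) gp (y a) (y b) i) => s3 h1 h2.
      have h3 : C * s2 <= C * (2 * C * 2^-1 ^+ n) by rewrite ler_pM2l.
      have h4 : C * C * s1 <= C * C * (2 * C * 2^-1 ^+ n) by rewrite ler_pM2l.
      by rewrite /K; lra.
    apply: bounded_sumsD.
      apply: (@bounded_sums_le _ _ (fun n => 2^-1 ^+ n) K) => // [n|].
        by rewrite mulr_ge0 ?exprn_ge0.
      exact: bounded_sums_pow2.
    apply: (@bounded_sums_le _ _ _ (C * C) _ (ltW C20) _ hb) => // n.
    by rewrite mulr_ge0 ?(ltW C20) // sumr_ge0.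
  apply: (@bounded_sums_le _ _ (fun n => (K * 2^-1 ^+ n) + C * C * d n (a n) (b n)) 1) => // [n|n|].
  - by apply: sumr_ge0.
  - apply: le_trans (triple _ (z n (a n)) (z n (b n)) _ _ _) _; rewrite mul1r.
    have := yz a aV n; have := yz' b bV n; rewrite -/gp -/(d _ _ _).
    move: (\sum_(_ <= i < _) gp (y a) _ i) => s1; move: (\sum_(_ <= i < _) gp _ (y b) i) => s2.
    move: (d _ _ _) => s3 h1 h2.
    have h3 : C * s1 <= C * (2 * C * 2^-1 ^+ n) by rewrite ler_pM2l.
    have h4 : C * C * s2 <= C * C * (2 * C * 2^-1 ^+ n) by rewrite ler_pM2l.
    by rewrite /K; lra.
  - apply: bounded_sumsD.
      apply: (@bounded_sums_le _ _ (fun n => 2^-1 ^+ n) K) => // [n|].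
        by rewrite mulr_ge0 ?exprn_ge0.
      exact: bounded_sums_pow2.
    apply: (@bounded_sums_le _ _ _ (C * C) _ (ltW C20) _ hb) => // n.
    by rewrite mulr_ge0 ?(ltW C20).
pose e n := d n (0%N, m n) (m n, m n).
(* [k n] counts the earlier blocks with [e < 2^- k]; were it unbounded, moving [0] to [1] in
   these blocks only would have summable cost. *)
have [n0 [c1 c1_gt0 hc1]] : exists n0, exists2 c1, 0 < c1 & forall n, (n0 <= n)%N -> c1 <= e n.
  pose k := fix k n := if n is n'.+1 then (k n' + (e n' < 2^-1 ^+ k n')%R)%N else 0%N.
  have [[n0 hn0]|nk] := pselect (exists n0, forall n, (n0 <= n)%N -> ~~ (e n < 2^-1 ^+ k n)).
    exists n0, (2^-1 ^+ k n0); first by rewrite exprn_gt0.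
    have kE n : (n0 <= n)%N -> k n = k n0.
      elim: n => [|n IHn]; first by rewrite leqn0 => /eqP ->.
      rewrite leq_eqVlt => /orP[/eqP <- //|]; rewrite ltnS => nn.
      by rewrite /= (negbTE (hn0 n nn)) addn0 IHn.
    by move=> n nn; rewrite -(kE n nn) leNgt hn0.
  exfalso; pose a n := (0%N, m n).
  pose b n := if e n < 2^-1 ^+ k n then (m n, m n) else (0%N, m n).
  have aV n : a n \in V n by exact: inV.
  have bV n : b n \in V n by rewrite /b; case: ifP => _; exact: inV.
  have : bounded_sums (fun n => gd (a n) (b n)).
    apply/(block_red a b aV bV); exists 2 => n.
    (* The cost is a geometric series in the counter: each increase of [k] spends at most
       [2^-1 ^+ k n]. *)
    apply: (@le_trans _ _ (2 - 2 * 2^-1 ^+ k n)); last first.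
      by rewrite gerBl mulr_ge0 // exprn_ge0.
    elim: n => [|n IHn]; first by rewrite big_geq // expr0; lra.
    rewrite big_nat_recr //=; move: IHn; rewrite /b; case: ifPn => en IHn.
      by apply: le_trans (lerD IHn (ltW en)) _; rewrite addn1 exprS; lra.
    by rewrite dd !addn0 addr0.
  have gk n : \sum_(0 <= i < n) gd (a i) (b i) = g 1 *+ k n.
    elim: n => [|n IHn]; first by rewrite big_geq.
    rewrite big_nat_recr //= IHn mulrnDr /b; case: ifP => _; last by rewrite gd0.
    rewrite mulr1n /gd /a grid_dist // sub0r normrN normr_nat divff //.
    by rewrite pnatr_eq0 -lt0n.
  have k_unb j : exists n, (j <= k n)%N.
    elim: j => [|j [n jn]]; first by exists 0%N.
    apply: contrapT => nex; apply: nk; exists n => n' nn'; apply/negP => en'.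
    have kmono i i' : (i <= i')%N -> (k i <= k i')%N.
      elim: i' => [|i' IHi']; first by rewrite leqn0 => /eqP ->.
      rewrite leq_eqVlt => /orP[/eqP -> //|]; rewrite ltnS => /IHi' /leq_trans; apply.
      by rewrite /= leq_addr.
    by apply: nex; exists n'.+1; rewrite /= en' addn1 ltnS (leq_trans jn) // kmono.
  move=> [K hK]; have [n hn] := k_unb (Num.truncn (K / g 1)).+1.
  have := hK n; rewrite gk -mulr_natr -ler_pdivlMl // [_ * K]mulrC leNgt => /negP; apply.
  by apply: lt_le_trans (truncnS_gt _) _; rewrite ler_nat.
(* Otherwise all [m n] steps from [0] to [1] would be too cheap: [f_chain], applied to each
   coordinate and summed over the block, bounds their total cost below by a multiple of
   [e n >= c1]. *)
have hstep n : exists i, (i < m n)%N /\ ((n0 <= n)%N ->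
    c * c1 * f (m n)%:R^-1 <= d n (i, m n) (i.+1, m n)).
  have [nn|nn] := leqP n0 n; last by exists 0%N; split => //; rewrite leqNgt nn.
  apply: contrapT => nex.
  have small i : (i < m n)%N -> d n (i, m n) (i.+1, m n) < c * c1 * f (m n)%:R^-1.
    by move=> im; rewrite ltNge; apply/negP => hi; apply: nex; exists i; split.
  have : c * (m n)%:R * f (m n)%:R^-1 * e n <= \sum_(0 <= i < m n) d n (i, m n) (i.+1, m n).
    rewrite exchange_big /= mulr_sumr; apply: ler_sum => j _.
    by apply: (f_chain (m n) (fun i => Theta (z n (i, m n)) j) (m_gt0 n)) => i; exact: Theta01.
  apply/negP; rewrite -ltNge.
  have fm0 : 0 <= f (m n)%:R^-1.
    by apply: f_ge0; exact: minv01.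
  apply: (@lt_le_trans _ _ (\sum_(0 <= i < m n) c * c1 * f (m n)%:R^-1)).
    by apply: ltr_sum_nat => // i /andP[_]; exact: small.
  rewrite sumr_const_nat subn0 -[leLHS]mulr_natr.
  have -> : c * c1 * f (m n)%:R^-1 * (m n)%:R = c * (m n)%:R * f (m n)%:R^-1 * c1 by ring.
  by rewrite ler_wpM2l ?hc1 // !mulr_ge0 // (ltW c_gt0).
have /choice[i hi] := hstep.
(* In every block [a] and [b] differ by exactly one grid step, so their distance series is that of
   [g (m n)%:R^-1], while from [n0] on the block costs dominate a multiple of [f (m n)%:R^-1]. *)
pose a n := (i n, m n); pose b n := ((i n).+1, m n).
have aV n : a n \in V n by apply: inV; apply: ltnW; exact: (hi n).1.
have bV n : b n \in V n by apply: inV; exact: (hi n).1.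
apply: f_not_summable.
have fm_ge0 n : 0 <= f (m n)%:R^-1.
  by apply: f_ge0; exact: minv01.
have cc1 : 0 < c * c1 by rewrite mulr_gt0.
apply: (@bounded_sums_le _ _ (fun n => (if (n < n0)%N then f (m n)%:R^-1 else 0) +
   (c * c1)^-1 * d n (a n) (b n)) 1) => // [n|].
  rewrite mul1r; case: ltnP => nn; first by rewrite lerDl mulr_ge0 ?invr_ge0 // ltW.
  by rewrite add0r ler_pdivlMl // (hi n).2.
apply: bounded_sumsD.
  apply: (@bounded_sums_finite _ _ n0) => n; first by case: ifP.
  by rewrite ltnNge => ->.
have : bounded_sums (fun n => gd (a n) (b n)).
  apply: (@bounded_sums_le _ _ (fun n => g (m n)%:R^-1) 1) => // n.
  rewrite mul1r /gd grid_dist ?(ltnW (hi n).1) ?(hi n).1 //.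
  by rewrite -natr1 opprD addrA subrr sub0r normrN normr1 mul1r.
move=> /(block_red a b aV bV) hb.
have cc1' : 0 <= (c * c1)^-1 by rewrite invr_ge0 ltW.
apply: (@bounded_sums_le _ _ _ (c * c1)^-1 _ cc1' _ hb) => // n.
by rewrite mulr_ge0.
Qed.

End NonReducibility.

(** * Reducibility *)

Section Waves.
Context {R : realType}.
Implicit Types u v s t : R.

Lemma sin_le s : 0 <= s -> `|sin s| <= s.
Proof.
rewrite le_eqVlt => /orP[/eqP <-|s0]; first by rewrite sin0 normr0.
have [|x _] := @MVT R sin cos 0 s s0 (fun x _ => is_derive_sin x).
  exact/continuous_subspaceT/continuous_sin.
rewrite sin0 !subr0 => ->; rewrite normrM (gtr0_norm s0).
by rewrite ler_piMl ?(ltW s0) // cos_max.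
Qed.

Lemma sin_ge_half s : 0 <= s <= 1 -> s / 2 <= sin s.
Proof.
rewrite le_eqVlt => /andP[/orP[/eqP <- _|s0 s1]]; first by rewrite sin0 mul0r.
have [|x xs] := @MVT R sin cos 0 s s0 (fun x _ => is_derive_sin x).
  exact/continuous_subspaceT/continuous_sin.
rewrite sin0 !subr0 => ->; rewrite mulrC ler_pM2r //.
move: xs; rewrite in_itv /= => /andP[x0 xs].
have -> : x = (x / 2) *+ 2 by rewrite -mulr_natr divfK // pnatr_eq0.
rewrite cos_mulr2n cos2sin2.
have h : `|sin (x / 2)| <= x / 2 by apply: sin_le; lra.
have h2 : sin (x / 2) ^+ 2 <= (x / 2) ^+ 2.
  by rewrite -(real_normK (num_real (sin _))) lerXn2r ?nnegrE //; lra.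
have : (x / 2) ^+ 2 <= (1 / 2) ^+ 2 by rewrite lerXn2r ?nnegrE //; lra.
by rewrite [(1 - _) *+ 2]mulr2n; lra.
Qed.

Definition wave (b : bool) t := if b then cos t else sin t.

Lemma waveB b u v : wave b u - wave b v =
  2 * (if b then - sin ((u + v) / 2) else cos ((u + v) / 2)) * sin ((u - v) / 2).
Proof.
have eu : (u + v) / 2 + (u - v) / 2 = u by field.
have ev : (u + v) / 2 - (u - v) / 2 = v by field.
rewrite -[in LHS]eu -[X in _ - wave _ X]ev.
move: ((u + v) / 2) ((u - v) / 2) => p s.
by case: b; rewrite /wave ?cosD ?sinD cosN sinN; ring.
Qed.

Lemma norm_sin t : `|sin t| = `|sin `|t| |.
Proof. by case: (ger0P t) => _ //; rewrite sinN normrN. Qed.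

Lemma wave_lipschitz b u v : `|wave b u - wave b v| <= `|u - v|.
Proof.
rewrite waveB normrM normrM.
have h : `|sin ((u - v) / 2)| <= `|u - v| / 2.
  rewrite norm_sin normrM (ger0_norm (_ : 0 <= 2^-1)) ?invr_ge0 //.
  by apply: sin_le; rewrite divr_ge0.
have h' : `|if b then - sin ((u + v) / 2) else cos ((u + v) / 2)| <= 1.
  by case: b; rewrite ?normrN ?sin_max ?cos_max.
rewrite (ger0_norm (_ : 0 <= 2)) // -mulrA.
by have := normr_ge0 (sin ((u - v) / 2)); nra.
Qed.

(** Sine and cosine are used together since each is flat somewhere: the squares of the two
    differences add up to [4 * sin s ^+ 2], so both cannot be small. *)
Lemma wave_separates u v : `|u - v| <= 1 ->
  exists b, `|u - v| / 4 <= `|wave b u - wave b v|.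
Proof.
move=> uv1; set s := (u - v) / 2.
have hs : `|u - v| / 4 <= `|sin s|.
  rewrite norm_sin; apply: le_trans (ler_norm _).
  have es : `|s| = `|u - v| / 2.
    by rewrite /s normrM (ger0_norm (_ : 0 <= 2^-1)) // invr_ge0.
  rewrite (_ : `|u - v| / 4 = `|s| / 2); last by rewrite es; field.
  by apply: sin_ge_half; rewrite normr_ge0 es /=; lra.
have e0 : (wave false u - wave false v) ^+ 2 + (wave true u - wave true v) ^+ 2 = 4 * sin s ^+ 2.
  rewrite !waveB -/s; have := cos2Dsin2 ((u + v) / 2).
  move: (cos _) (sin ((u + v) / 2)) (sin s) => p q r pq.
  have -> : (2 * p * r) ^+ 2 + (2 * - q * r) ^+ 2 = 4 * (p ^+ 2 + q ^+ 2) * r ^+ 2 by ring.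
  by rewrite pq mulr1.
have [h|h] := leP (`|u - v| / 4) `|wave false u - wave false v|; first by exists false.
exists true; rewrite leNgt; apply/negP => h'.
have sq (w : R) : `|w| < `|u - v| / 4 -> w ^+ 2 <= sin s ^+ 2.
  move=> hw; rewrite -(real_normK (num_real w)) -(real_normK (num_real (sin s))).
  by rewrite lerXn2r ?nnegrE // (le_trans (ltW hw)).
have := sq _ h; have := sq _ h'.
have s0 : 0 < sin s ^+ 2.
  rewrite exprn_even_gt0 //= -normr_gt0 (lt_le_trans _ hs) //.
  by apply: le_lt_trans h; exact: normr_ge0.
lra.
Qed.

Lemma continuous_wave b : continuous (wave b).
Proof. by case: b; [exact: continuous_cos | exact: continuous_sin]. Qed.

End Waves.

(** * Continuous maps into the cube *)

Section Continuity.
Context {R : realType}.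

Lemma continuous_cube (F : hilbert_cube R -> hilbert_cube R) :
  (forall i, continuous (fun x => set_val (F x i) : R)) -> continuous F.
Proof.
move=> cF x; have FF : Filter (F @ x) by apply: fmap_filter; exact: nbhs_filter.
apply/cvg_sup => i.
have ci : continuous (fun x => F x i).
  by apply: continuous_comp_initial; exact: cF.
move=> U [V] [[W] oW <-] WF WU.
have : nbhs (F x i) W by apply: open_nbhs_nbhs.
by move=> /(ci x); apply: (@filterS _ (nbhs x)) => z /= ?; exact: WU.
Qed.

Lemma continuous_borel (X Y : topologicalType) (F : X -> Y) :
  continuous F -> borel_fun F.
Proof.
move=> /continuousP cF B.
suff : <<s @open Y >> `<=` [set B | <<s @open X >> (F @^-1` B)] by apply.
have sX : sigma_algebra setT <<s @open X >> by exact: smallest_sigma_algebra.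
case: sX => s0 sC sU; apply: smallest_sub; last first.
  by move=> U oU; apply: sub_sigma_algebra; exact: cF.
split; first by rewrite /= preimage_set0.
  by move=> A; rewrite /= setTD preimage_setC -setTD; exact: sC.
by move=> A hA; rewrite /= preimage_bigcup; exact: sU.
Qed.

End Continuity.

(** * Reduction by waves of all dyadic frequencies *)

Section Reducibility.
Context {R : realType}.

(** By Tonelli for nonnegative terms the series along the enumeration [e] is the iterated one, and
    each inner sum is comparable to [F n]. *)
Lemma bounded_sums_prod (e : nat -> nat * nat) (u : nat -> nat -> R) (F : nat -> R) (K : R) :
  set_bij [set: nat] [set: nat * nat] e ->
  (forall n j, 0 <= u n j) -> (forall n, 0 <= F n) -> 0 <= K ->
  (forall n m, \sum_(0 <= j < m) u n j <= K * F n) ->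
  (forall n, exists m, F n <= K * \sum_(0 <= j < m) u n j) ->
  bounded_sums F <-> bounded_sums (fun i => u (e i).1 (e i).2).
Proof.
move=> be u0 F0 K0 uF Fu.
rewrite -!nneseries_lt_pinfty //.
have u0E n j : (0 <= (u n j)%:E)%E by rewrite lee_fin.
have F0E n : (0 <= (F n)%:E)%E by rewrite lee_fin.
have s0 n : (0 <= \sum_(0 <= j <oo) (u n j)%:E)%E by exact: nneseries_ge0.
have -> : (\sum_(0 <= i <oo) (u (e i).1 (e i).2)%:E =
    \sum_(0 <= n <oo) \sum_(0 <= j <oo) (u n j)%:E)%E.
  rewrite nneseries_esumT // -(@reindex_esum _ _ _ _ _ e (fun p => (u p.1 p.2)%:E) be).
  rewrite nneseries_esumT // (@eq_esum _ _ _ _ (fun n => \esum_(j in [set: nat]) (u n j)%:E)%E).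
    rewrite (@esum_esum _ _ _ setT (fun=> setT)) //; congr esum.
    by apply/seteqP; split.
  by move=> n _; rewrite nneseries_esumT.
have up n : (\sum_(0 <= j <oo) (u n j)%:E <= K%:E * (F n)%:E)%E.
  rewrite -EFinM; apply: lime_le; first exact: is_cvg_nneseries.
  by apply: nearW => m; rewrite sumEFin lee_fin.
have down n : ((F n)%:E <= K%:E * \sum_(0 <= j <oo) (u n j)%:E)%E.
  have [m hm] := Fu n; apply: (@le_trans _ _ (K * \sum_(0 <= j < m) u n j)%:E).
    by rewrite lee_fin.
  rewrite EFinM; apply: lee_wpmul2l; first by rewrite lee_fin.
  by rewrite -sumEFin; exact: nneseries_lim_ge.
split=> h.
  apply: (@le_lt_trans _ _ (K%:E * \sum_(0 <= n <oo) (F n)%:E)%E).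
    by rewrite -nneseriesZl //; apply: lee_nneseries.
  by rewrite lte_mul_pinfty // lee_fin.
apply: (@le_lt_trans _ _ (K%:E * \sum_(0 <= n <oo) \sum_(0 <= j <oo) (u n j)%:E)%E).
  by rewrite -nneseriesZl //; apply: lee_nneseries.
by rewrite lte_mul_pinfty // lee_fin.
Qed.

Lemma nat_pair_bij : exists e : nat -> nat * nat, set_bij [set: nat] [set: nat * nat] e.
Proof. by have /card_esym/card_set_bijP := card_nat2. Qed.

Lemma dyadic_scale (t : R) : 0 < t <= 1 -> exists j, 2^-1 ^+ j.+1 < t <= 2^-1 ^+ j.
Proof.
move=> /andP[t0 t1].
have ex : exists j, (2^-1 ^+ j.+1 < t).
  exists (Num.truncn t^-1); rewrite exprVn -[ltRHS]invrK.
  rewrite ltf_pV2 ?posrE ?invr_gt0 ?exprn_gt0 //.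
  apply: lt_trans (truncnS_gt _) _.
  by rewrite -natrX ltr_nat ltn_expl.
exists (ex_minn ex); case: ex_minnP => j jt jmin; rewrite jt /=.
case: j jt jmin => [|j] jt jmin; first by rewrite expr0.
by rewrite leNgt; apply/negP => /jmin; rewrite ltnn.
Qed.

Variables (f g : R -> R) (kappa : nat -> R) (A B C c : R).
Hypothesis f_ge0 : forall x : R, 0 <= x <= 1 -> 0 <= f x.
Hypothesis f0 : f 0 = 0.
Hypothesis f_le : forall x y : R, 0 <= x <= y -> y <= 1 -> f x <= f y.
Hypothesis B_gt0 : 0 < B.
Hypothesis f_half : forall x : R, 0 <= x <= 1 -> f x <= B * f (x / 2).
Hypothesis g_ge0 : forall x : R, 0 <= x <= 1 -> 0 <= g x.
Hypothesis g0 : g 0 = 0.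
Hypothesis g_le : forall x y : R, 0 <= x <= y -> y <= 1 -> g x <= g y.
Hypothesis A_gt0 : 0 < A.
Hypothesis g_half : forall x : R, 0 <= x <= 1 -> g x <= A * g (x / 16).
Hypothesis kappa01 : forall k, 0 <= kappa k <= 1.
Hypothesis C_gt0 : 0 < C.
Hypothesis head_le : forall j,
  \sum_(0 <= k < j.+1) g (kappa k * 2^-1 ^+ (j - k)) <= C * f (2^-1 ^+ j).
Hypothesis tail_le : forall j n, \sum_(j <= k < n) g (kappa k) <= C * f (2^-1 ^+ j).
Hypothesis c_gt0 : 0 < c.
Hypothesis head_ge : forall j,
  c * f (2^-1 ^+ j) <= \sum_(0 <= k < j.+1) g (kappa k * 2^-1 ^+ (j - k)).

Definition coordinate (k : nat) (b : bool) (x : R) : R :=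
  kappa k * ((1 + wave b (2 ^+ k * x)) / 2).

Lemma continuous_coordinate k b : continuous (coordinate k b).
Proof.
have -> : coordinate k b =
    (fun=> kappa k) \* (((fun=> 1) + (wave b \o ( *%R (2 ^+ k)))) \* (fun=> 2^-1)) by [].
move=> x; apply: continuousM; first exact: cvg_cst.
apply: continuousM; last exact: cvg_cst.
apply: continuousD; first exact: cvg_cst.
apply: continuous_comp; last exact: continuous_wave.
by apply: (@continuousM _ _ (fun=> 2 ^+ k) id); [exact: cvg_cst | exact: cvg_id].
Qed.

Lemma coordinate_itv k b x : 0 <= coordinate k b x <= 1.
Proof.
have /andP[k0 k1] := kappa01 k.
have : `|wave b (2 ^+ k * x)| <= 1 by case: b; [exact: cos_max | exact: sin_max].
rewrite ler_norml => /andP[w0 w1].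
have h0 : 0 <= (1 + wave b (2 ^+ k * x)) / 2 by lra.
have h1 : (1 + wave b (2 ^+ k * x)) / 2 <= 1 by lra.
by rewrite mulr_ge0 //= mulr_ile1.
Qed.

Lemma coordinate_dist k b x y : `|coordinate k b x - coordinate k b y| =
  kappa k * (`|wave b (2 ^+ k * x) - wave b (2 ^+ k * y)| / 2).
Proof.
have /andP[k0 k1] := kappa01 k.
rewrite -mulrBr normrM (ger0_norm k0) -mulrBl opprD addrACA subrr add0r.
by rewrite normrM (ger0_norm (_ : 0 <= 2^-1)) // invr_ge0.
Qed.

Lemma coordinate_dist_itv k b x y : 0 <= `|coordinate k b x - coordinate k b y| <= 1.
Proof.
rewrite normr_ge0 /=; have := coordinate_itv k b x; have := coordinate_itv k b y.
by rewrite ler_norml; lra.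
Qed.

Definition energy k b x y := g `|coordinate k b x - coordinate k b y|.

Lemma energy_ge0 k b x y : 0 <= energy k b x y.
Proof. exact/g_ge0/coordinate_dist_itv. Qed.

(** For [|x - y|] between [2^-1 ^+ j.+1] and [2^-1 ^+ j], the frequencies up to [j] are controlled
    by the Lipschitz bound and the others by the amplitude alone. In [4], one factor [2] counts the
    two waves, the other the head and the tail. *)
Lemma energy_sum_le (x y : R) n : 0 <= x <= 1 -> 0 <= y <= 1 ->
  \sum_(0 <= k < n) (energy k false x y + energy k true x y) <= 4 * C * B * f `|x - y|.
Proof.
move=> x01 y01; have [->|xy] := eqVneq x y.
  rewrite subrr normr0 f0 mulr0 big1 // => k _.
  by rewrite /energy !subrr normr0 g0 addr0.
have t01 : 0 < `|x - y| <= 1.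
  by rewrite normr_gt0 subr_eq0 xy ler_norml; move: x01 y01; lra.
have [j /andP[jt tj]] := dyadic_scale _ t01.
have fj : f (2^-1 ^+ j) <= B * f `|x - y|.
  apply: le_trans (f_half _ _) _; first by rewrite exprn_ge0 // exprn_ile1 // invf_le1 // ler1n.
  rewrite ler_pM2l //; apply: f_le; last by case/andP: t01.
  by rewrite -exprSr (ltW jt) exprn_ge0.
pose P k := if (k <= j)%N then g (kappa k * 2^-1 ^+ (j - k)) else g (kappa k).
have q01 i : 0 <= (2^-1 ^+ i : R) <= 1.
  by rewrite exprn_ge0 // exprn_ile1 // invf_le1 // ler1n.
have kq01 k i : 0 <= kappa k * 2^-1 ^+ i <= 1.
  by have /andP[? ?] := kappa01 k; have /andP[? ?] := q01 i; rewrite mulr_ge0 //= mulr_ile1.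
have eP k b : energy k b x y <= P k.
  have /andP[k0 k1] := kappa01 k.
  rewrite /energy /P; case: leqP => kj; apply: g_le; rewrite ?normr_ge0 //=.
  - rewrite coordinate_dist ler_wpM2l //.
    have h := wave_lipschitz b (2 ^+ k * x) (2 ^+ k * y).
    rewrite -mulrBr normrM (ger0_norm (_ : 0 <= 2 ^+ k)) ?exprn_ge0 // in h.
    have h' : 2 ^+ k * `|x - y| <= 2^-1 ^+ (j - k).
      have -> : 2^-1 ^+ (j - k) = 2 ^+ k * 2^-1 ^+ j :> R.
        by rewrite -{2}(subnKC kj) exprD mulrA -exprMn divff // expr1n mul1r.
      by rewrite ler_pM2l ?exprn_gt0.
    by have := normr_ge0 (wave b (2 ^+ k * x) - wave b (2 ^+ k * y)); lra.
  - by case/andP: (kq01 k (j - k)%N).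
  - rewrite coordinate_dist ler_piMr //.
    have : `|wave b (2 ^+ k * x)| <= 1 by case: (b); [exact: cos_max | exact: sin_max].
    have : `|wave b (2 ^+ k * y)| <= 1 by case: (b); [exact: cos_max | exact: sin_max].
    by have := ler_normB (wave b (2 ^+ k * x)) (wave b (2 ^+ k * y)); lra.
have P0 k : 0 <= P k by rewrite /P; case: ifP => _; apply: g_ge0.
have hP : \sum_(0 <= k < n) P k <= 2 * C * f (2^-1 ^+ j).
  apply: (@le_trans _ _ (\sum_(0 <= k < maxn j.+1 n) P k)).
    by apply: sum_widen => //; rewrite leq_maxr.
  rewrite (@big_cat_nat _ _ _ j.+1) ?leq_maxl //= -mulrA mulrDl mul1r lerD //.
    rewrite (eq_big_nat _ _ (F2 := fun k => g (kappa k * 2^-1 ^+ (j - k)))) //.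
    by move=> k /andP[_]; rewrite ltnS /P => ->.
  rewrite (eq_big_nat _ _ (F2 := fun k => g (kappa k))).
    apply: le_trans (tail_le j (maxn j.+1 n)); apply: sum_widen => // k.
    exact: g_ge0.
  by move=> k /andP[jk _]; rewrite /P leqNgt jk.
apply: (@le_trans _ _ (2 * \sum_(0 <= k < n) P k)).
  by rewrite mulr_sumr; apply: ler_sum => k _; have := eP k false; have := eP k true; lra.
have h : C * f (2^-1 ^+ j) <= C * (B * f `|x - y|) by rewrite ler_pM2l.
lra.
Qed.

(** The frequencies up to [j] suffice: there the phase difference is at most [1], so one of the two
    waves separates the points. *)
Lemma energy_sum_ge (x y : R) : 0 <= x <= 1 -> 0 <= y <= 1 -> exists n,
  f `|x - y| <= c^-1 * A * \sum_(0 <= k < n) (energy k false x y + energy k true x y).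
Proof.
move=> x01 y01; have [->|xy] := eqVneq x y.
  by exists 0%N; rewrite subrr normr0 f0 big_geq // mulr0.
have t01 : 0 < `|x - y| <= 1.
  by rewrite normr_gt0 subr_eq0 xy ler_norml; move: x01 y01; lra.
have [j /andP[jt tj]] := dyadic_scale _ t01.
exists j.+1.
have q01 i : 0 <= (2^-1 ^+ i : R) <= 1.
  by rewrite exprn_ge0 // exprn_ile1 // invf_le1 // ler1n.
apply: (@le_trans _ _ (f (2^-1 ^+ j))).
  by apply: f_le; [rewrite normr_ge0|case/andP: (q01 j)].
rewrite -mulrA ler_pdivlMl //; apply: le_trans (head_ge j) _.
rewrite mulr_sumr; apply: ler_sum_nat => k /andP[_]; rewrite ltnS => kj.
have /andP[k0 k1] := kappa01 k.
have k01 : 0 <= kappa k * 2^-1 ^+ (j - k) <= 1.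
  by have /andP[? ?] := q01 (j - k)%N; rewrite mulr_ge0 //= mulr_ile1.
apply: le_trans (g_half _ k01) _; rewrite ler_pM2l //.
have e : 2^-1 ^+ (j - k) = 2 ^+ k * 2^-1 ^+ j :> R.
  by rewrite -{2}(subnKC kj) exprD mulrA -exprMn divff // expr1n mul1r.
have [|b hb] := wave_separates (2 ^+ k * x) (2 ^+ k * y).
  rewrite -mulrBr normrM (ger0_norm (_ : 0 <= 2 ^+ k)) ?exprn_ge0 //.
  apply: (@le_trans _ _ (2 ^+ k * 2^-1 ^+ j)); first by rewrite ler_pM2l ?exprn_gt0.
  by rewrite -e; case/andP: (q01 (j - k)%N).
rewrite -mulrBr normrM (ger0_norm (_ : 0 <= 2 ^+ k)) ?exprn_ge0 // in hb.
(* The factor [16] collects [4] from [wave_separates], [2] from the rescaling of the wave and [2]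
   from [|x - y| > 2^-1 ^+ j.+1]. *)
have hE : g (kappa k * 2^-1 ^+ (j - k) / 16) <= energy k b x y.
  apply: g_le; last by case/andP: (coordinate_dist_itv k b x y).
  rewrite divr_ge0 //=; last by case/andP: k01.
  rewrite coordinate_dist -mulrA ler_wpM2l //.
  have h1 : 2^-1 ^+ (j - k) <= 2 ^+ k * `|x - y| * 2.
    rewrite e -mulrA ler_pM2l ?exprn_gt0 //.
    by move: jt; rewrite exprSr; lra.
  by lra.
apply: le_trans hE _.
by case: b {hb}; rewrite ?lerDl ?lerDr energy_ge0.
Qed.

(* Even and odd [j] carry the sine and the cosine wave of frequency [2 ^ (j / 2)]. *)
Lemma abstract_reduction : borel_reducible (Erel f) (Erel g).
Proof.
have [e be] := nat_pair_bij.
pose h (x : hilbert_cube R) : hilbert_cube R := fun i =>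
  SigSub (mem_set (coordinate_itv (e i).2./2 (odd (e i).2) (set_val (x (e i).1))) :
    coordinate (e i).2./2 (odd (e i).2) (set_val (x (e i).1)) \in (`[0, 1]%classic : set R)).
have hE x i : set_val (h x i) = coordinate (e i).2./2 (odd (e i).2) (set_val (x (e i).1)) by [].
exists h.
  apply: (@continuous_borel (hilbert_cube R) (hilbert_cube R) h); apply: continuous_cube => i.
  move=> x; apply: (@continuous_comp (hilbert_cube R) R R (fun x => set_val (x (e i).1))
    (coordinate (e i).2./2 (odd (e i).2))); first exact: cube_coord_continuous.
  exact: continuous_coordinate.
move=> x y; rewrite !Erel_bounded_sums //.
pose X n : R := set_val (x n); pose Y n : R := set_val (y n).
have X01 n : 0 <= X n <= 1 by exact: cube_coord_itv.
have Y01 n : 0 <= Y n <= 1 by exact: cube_coord_itv.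
pose u n j := energy j./2 (odd j) (X n) (Y n).
have u0 n j : 0 <= u n j by exact: energy_ge0.
have d01 n : 0 <= `|X n - Y n| <= 1.
  by rewrite normr_ge0 ler_norml; have := X01 n; have := Y01 n; lra.
have even_sum n m : \sum_(0 <= j < m.*2) u n j =
    \sum_(0 <= k < m) (energy k false (X n) (Y n) + energy k true (X n) (Y n)).
  elim: m => [|m IHm]; first by rewrite !big_geq.
  rewrite doubleS !big_nat_recr //= IHm /u -addrA.
  by rewrite -[m.*2.+1./2]/(uphalf m.*2) uphalf_double doubleK /= odd_double.
pose K := 4 * C * B + c^-1 * A.
have K1 : 0 <= 4 * C * B by rewrite !mulr_ge0 // ltW.
have K2 : 0 <= c^-1 * A by rewrite mulr_ge0 ?invr_ge0 // ltW.
apply: (@bounded_sums_prod e u (fun n => f `|X n - Y n|) K) => //.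
- by move=> n; exact: f_ge0.
- by rewrite addr_ge0.
- move=> n m; apply: (@le_trans _ _ (4 * C * B * f `|X n - Y n|)).
    apply: le_trans (energy_sum_le (X n) (Y n) m _ _) => //.
    rewrite -even_sum; apply: sum_widen => //.
    by rewrite -addnn leq_addr.
  by rewrite ler_wpM2r ?f_ge0 // lerDl.
- move=> n; have [m hm] := energy_sum_ge (X n) (Y n) (X01 n) (Y01 n).
  exists m.*2; apply: le_trans hm _; rewrite even_sum.
  rewrite ler_wpM2r ?lerDr // sumr_ge0 // => k _.
  by rewrite addr_ge0 ?energy_ge0.
Qed.

End Reducibility.

(** * Application to [x ^ alpha / l_eta] *)

Section PowerLogReduction.
Context {R : realType}.
Variables (a b : nat -> R) (N p : nat).
Hypothesis pN : (p <= N)%N.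
Hypothesis ab_eq : forall i, (i < p)%N -> a i = b i.
Hypothesis ab_lt : a p < b p.
Hypothesis a_ge0 : forall i, 0 <= a i.
Hypothesis b_ge0 : forall i, 0 <= b i.
Hypothesis a0_ge1 : 1 <= a 0%N.

Local Notation f := (plog a N).
Local Notation g := (plog b N).
Local Notation q k := (2^-1 ^+ k : R).

Lemma a0_le_b0 : a 0%N <= b 0%N.
Proof.
by case: p ab_eq ab_lt => [_ /ltW//|p' h _]; rewrite h.
Qed.

Lemma b0_ge1 : 1 <= b 0%N.
Proof. exact: le_trans a0_ge1 a0_le_b0. Qed.

Lemma pow2_itv k : 0 < q k <= 1.
Proof. by rewrite exprn_gt0 //= exprn_ile1 // invf_le1 // ler1n. Qed.

Let L k := f (q k) / g (q k).

Let L_gt0 k : 0 < L k.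
Proof. by rewrite divr_gt0 // plog_gt0 // pow2_itv. Qed.

Let L0 : L 0%N = 1.
Proof. by rewrite /L expr0 !plog1 divr1. Qed.

Let LE k : f (q k) = L k * g (q k).
Proof. by rewrite divfK // gt_eqF // plog_gt0 // pow2_itv. Qed.

Let L_almost_mono : exists2 C, 1 <= C & forall i k, (i <= k)%N -> L i <= C * L k.
Proof.
have [C C0 hC] := plog_ratio_almost_mono a b N p pN ab_eq ab_lt.
have h i k : (i <= k)%N -> L i <= C * L k.
  move=> ik; have /andP[qk0 _] := pow2_itv k; have /andP[_ qi1] := pow2_itv i.
  by apply: hC => //; rewrite qk0 /= ler_wiXn2l // ?invr_ge0 // invf_le1 // ler1n.
by exists C => //; have := h 0%N 0%N (leqnn _); rewrite L0 mulr1.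
Qed.

Fixpoint Lmax k := if k is j.+1 then Num.max (Lmax j) (L k) else L 0%N.

(** The summand [q k] bounds [lam k] below, which will control the logarithms of the scaled
    arguments, and adds at most [2] to each sum. *)
Let lam k := (if k is j.+1 then Lmax k - Lmax j else Lmax 0%N) + q k.

Let lam_sum j : \sum_(0 <= k < j.+1) lam k = Lmax j + \sum_(0 <= k < j.+1) q k.
Proof.
elim: j => [|j IHj]; first by rewrite !big_nat1.
by rewrite big_nat_recr // IHj [in RHS]big_nat_recr // /lam /=; ring.
Qed.

Let L_le_Lmax k : L k <= Lmax k.
Proof. by case: k => //= k; rewrite le_max lexx orbT. Qed.

Let Lmax_ge0 k : 0 <= Lmax k.
Proof. exact: le_trans (ltW (L_gt0 k)) (L_le_Lmax k). Qed.

Let lam_ge k : q k <= lam k.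
Proof.
rewrite /lam lerDr; case: k => [|k] /=; first exact: ltW (L_gt0 0%N).
by rewrite subr_ge0 le_max lexx.
Qed.

Let lam_le k : lam k <= Lmax k + 1.
Proof.
rewrite /lam lerD //; last by case/andP: (pow2_itv k).
by case: k => // k; rewrite gerBl Lmax_ge0.
Qed.

(** Almost monotonicity makes the running maximum comparable to [L] itself. *)
Let Lmax_le C : 1 <= C -> (forall i k, (i <= k)%N -> L i <= C * L k) ->
  forall k, Lmax k <= C * L k.
Proof.
move=> C1 hC k; suff h n : (n <= k)%N -> Lmax n <= C * L k by exact: h.
elim: n => [|n IHn] nk; first exact: hC.
by rewrite /= ge_max IHn ?(ltnW nk) //= hC.
Qed.

(* [kappa k = 2^-k mu_k] with [mu_k ^ b_0] proportional to the increment [lam k] of the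
   running maximum of [f / g], so that summing over the scales telescopes. *)
Lemma kappa_exists : exists (kappa : nat -> R) (D D' : R), [/\
  0 < D, 0 < D', forall k, 0 <= kappa k <= 1 &
  forall k j, (k <= j)%N -> D' * lam k * g (q j) <= g (kappa k * q (j - k)) <= D * lam k * g (q j)].
Proof.
have [C C1 hC] := L_almost_mono.
have C0 : 0 < C by apply: lt_le_trans ltr01 C1.
have hLm := Lmax_le _ C1 hC.
have lamL k : lam k <= 2 * C * L k.
  apply: le_trans (lam_le k) _; have := hLm k; have := hC 0%N k (leq0n k).
  by rewrite L0; lra.
have al0 : 0 < a 0%N by apply: lt_le_trans ltr01 a0_ge1.
have ga0 : 0 < b 0%N by apply: lt_le_trans ltr01 b0_ge1.
(* The aim is to keep [q j * mu k] between a multiple of [q j ^ 2] and [q j ^ s], where [lg] is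
   comparable to its value at [q j]. Half of the power [a 0] is spent on bounding logarithms; the
   other half gives this exponent. *)
pose s := a 0%N / (2 * b 0%N).
have s0 : 0 < s by rewrite divr_gt0 // mulr_gt0.
have s1 : s <= 1 by rewrite ler_pdivrMr ?mulr_gt0 // mul1r; have := a0_le_b0; lra.
have [K K0 hK] := lg_powR_le b N (a 0%N / 2) (divr_gt0 al0 (ltr0Sn R 1)).
have hL k : L k <= K * q k `^ (a 0%N / 2 - b 0%N).
  have qk := pow2_itv k; have /andP[qk0 _] := qk.
  rewrite /L !plogE // invf_div.
  have -> : q k `^ a 0%N / lg a N (q k) * (lg b N (q k) / q k `^ b 0%N) =
      q k `^ a 0%N * lg b N (q k) / q k `^ b 0%N * (lg a N (q k))^-1 by ring.
  apply: (@le_trans _ _ (q k `^ a 0%N * lg b N (q k) / q k `^ b 0%N)).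
    apply: ler_piMr; first by rewrite divr_ge0 ?mulr_ge0 ?powR_ge0 ?(ltW (lg_gt0 _ _ _ qk)).
    by rewrite invf_le1 ?lg_gt0 // lg_ge1.
  apply: (@le_trans _ _ (q k `^ a 0%N * (K * q k `^ (- (a 0%N / 2))) / q k `^ b 0%N)).
    by rewrite ler_wpM2r ?invr_ge0 ?powR_ge0 // ler_wpM2l ?powR_ge0 // hK.
  rewrite mulrCA -mulrA -powRN -!powRD ?(gt_eqF qk0) ?implybT //.
  by rewrite le_eqVlt; apply/orP; left; apply/eqP; congr (_ * _ `^ _); field.
pose M := 2 * C * K.
have M0 : 0 < M by rewrite !mulr_gt0.
(* [b'] cancels the constant [M ^ (b 0)^-1] in the upper bound on [mu], and being at most [1] it is
   itself a legitimate argument of [lg]. *)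
pose b' := Num.min 1 (M `^ (- (b 0%N)^-1)).
have b'0 : 0 < b' by rewrite lt_min ltr01 powR_gt0.
have b'1 : b' <= 1 by rewrite ge_min lexx.
have b'01 : 0 < b' <= 1 by rewrite b'0.
pose mu k := b' * lam k `^ (b 0%N)^-1.
have lam0 k : 0 < lam k by apply: lt_le_trans (lam_ge k); case/andP: (pow2_itv k).
have mu_le k : mu k <= q k `^ (s - 1).
  have /andP[qk0 _] := pow2_itv k.
  apply: (@le_trans _ _ (M `^ (- (b 0%N)^-1) * (M * q k `^ (a 0%N / 2 - b 0%N)) `^ (b 0%N)^-1)).
    rewrite ler_pM ?powR_ge0 ?(ltW b'0) //; first by rewrite ge_min lexx orbT.
    rewrite ge0_ler_powR ?nnegrE ?invr_ge0 ?(ltW ga0) ?(ltW (lam0 k)) //.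
      by rewrite mulr_ge0 ?powR_ge0 ?(ltW M0).
    by apply: le_trans (lamL k) _; rewrite /M -!mulrA !ler_pM2l.
  rewrite (powRM _ (ltW M0) (powR_ge0 _ _)) mulrA -powRD ?(gt_eqF M0) ?implybT //.
  rewrite addNr powRr0 mul1r -powRrM le_eqVlt; apply/orP; left; apply/eqP; congr (_ `^ _).
  by rewrite /s; field; exact: lt0r_neq0.
have mu_ge k : b' * q k <= mu k.
  rewrite ler_pM2l //; have /andP[qk0 qk1] := pow2_itv k.
  apply: (@le_trans _ _ (q k `^ (b 0%N)^-1)).
    apply: ger1_powR; first exact: pow2_itv.
    by rewrite invf_le1 // b0_ge1.
  by rewrite ge0_ler_powR ?nnegrE ?invr_ge0 ?(ltW ga0) ?(ltW (lam0 k)) ?(ltW qk0).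
have mu0 k : 0 < mu k by rewrite mulr_gt0 // powR_gt0.
have w_le k j : (k <= j)%N -> q j * mu k <= q j `^ s.
  move=> kj; have /andP[qj0 qj1] := pow2_itv j; have /andP[qk0 _] := pow2_itv k.
  have -> : q j `^ s = q j * q j `^ (s - 1) by rewrite mulr_powRB1 // ltW.
  rewrite ler_pM2l //; apply: le_trans (mu_le k) _.
  have -> : s - 1 = - (1 - s) by ring.
  rewrite !powRN lef_pV2 ?posrE ?powR_gt0 //.
  rewrite ge0_ler_powR ?nnegrE ?subr_ge0 ?(ltW qj0) ?(ltW qk0) //.
  by rewrite ler_wiXn2l // ?invr_ge0 // invf_le1 // ler1n.
have [K2 K20 hK2] := lg_powR b N b_ge0 2 (ler1n R 2).
have [K3 K30 hK3] : exists2 K3, 0 < K3 &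
    forall x, 0 < x <= 1 -> lg b N (x `^ s^-1) <= K3 * lg b N x.
  by apply: lg_powR => //; rewrite invf_ge1.
exists (fun k => q k * mu k), (K3 * b' `^ b 0%N), (b' `^ b 0%N / (lg b N b' * K2)); split.
- by rewrite mulr_gt0 ?powR_gt0.
- by rewrite divr_gt0 ?powR_gt0 // mulr_gt0 // lg_gt0.
- move=> k; have qk := pow2_itv k; have /andP[qk0 qk1] := qk.
  rewrite mulr_ge0 ?(ltW qk0) ?(ltW (mu0 k)) //=.
  apply: le_trans (w_le k k (leqnn k)) _.
  by have /andP[] := powR_01 (q k) s qk (ltW s0).
move=> k j kj; have qj := pow2_itv j; have /andP[qj0 qj1] := qj.
have -> : q k * mu k * q (j - k) = q j * mu k by rewrite mulrAC -exprD subnKC.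
have wle := w_le k j kj.
have qs : 0 < q j `^ s <= 1 by exact: (powR_01 _ _ _ (ltW s0)).
have w0 : 0 < q j * mu k by rewrite mulr_gt0.
have w01 : 0 < q j * mu k <= 1 by rewrite w0 (le_trans wle) //; case/andP: qs.
have wge : b' * q j `^ 2 <= q j * mu k.
  rewrite (powR_mulrn 2 (ltW qj0)) expr2 mulrCA ler_pM2l //.
  apply: le_trans (mu_ge k); rewrite ler_pM2l //.
  by rewrite ler_wiXn2l // ?invr_ge0 // invf_le1 // ler1n.
have q201 : 0 < q j `^ 2 <= 1 by exact: powR_01.
have l_le : lg b N (q j * mu k) <= lg b N b' * K2 * lg b N (q j).
  apply: (@le_trans _ _ (lg b N (b' * q j `^ 2))).
    by apply: lg_le => //; [rewrite wge mulr_gt0 ?powR_gt0 | case/andP: w01].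
  apply: le_trans (lgM b N b_ge0 _ _ b'01 q201) _.
  by rewrite -mulrA ler_pM2l ?lg_gt0 // hK2.
have l_ge : lg b N (q j) <= K3 * lg b N (q j * mu k).
  have -> : lg b N (q j) = lg b N ((q j `^ s) `^ s^-1).
    by rewrite -powRrM divff ?lt0r_neq0 // powRr1 // ltW.
  apply: le_trans (hK3 _ qs) _; rewrite ler_pM2l //.
  by apply: lg_le; rewrite ?w0 //; case/andP: qs.
(* The power part is exact; only the logarithmic factors cost constants, through [l_le] and
   [l_ge]. *)
have muE : (q j * mu k) `^ b 0%N = b' `^ b 0%N * lam k * q j `^ b 0%N.
  rewrite /mu !powRM ?mulr_ge0 ?powR_ge0 ?(ltW b'0) ?(ltW qj0) //.
  by rewrite -powRrM mulVf ?lt0r_neq0 // powRr1 ?(ltW (lam0 k)) // mulrC.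
rewrite !plogE // muE.
have X0 : 0 < b' `^ b 0%N * lam k * q j `^ b 0%N by rewrite !mulr_gt0 ?powR_gt0.
have lw := lg_gt0 b N _ w01; have lj := lg_gt0 b N _ qj.
have lb : 0 < lg b N b' * K2 by rewrite mulr_gt0 // lg_gt0.
apply/andP; split.
  have -> : b' `^ b 0%N / (lg b N b' * K2) * lam k * (q j `^ b 0%N / lg b N (q j)) =
      b' `^ b 0%N * lam k * q j `^ b 0%N / (lg b N b' * K2 * lg b N (q j)).
    by rewrite [in RHS]invfM; ring.
  by rewrite ler_pM2l // lef_pV2 ?posrE // mulr_gt0.
have -> : K3 * b' `^ b 0%N * lam k * (q j `^ b 0%N / lg b N (q j)) =
    b' `^ b 0%N * lam k * q j `^ b 0%N * (K3 / lg b N (q j)) by ring.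
by rewrite ler_pM2l // ler_pdivlMr // mulrC ler_pdivrMr // mulrC.
Qed.

Lemma plog_reducible : borel_reducible (Erel f) (Erel g).
Proof.
have [C C1 hC] := L_almost_mono.
have C0 : 0 < C by apply: lt_le_trans ltr01 C1.
have hLm := Lmax_le _ C1 hC.
have [kappa [D [D' [D0 D'0 k01 hk]]]] := kappa_exists.
have f2 : 0 < f 2^-1 by apply: plog_gt0; lra.
have g16 : 0 < g 16^-1 by apply: plog_gt0; lra.
have g_gt0 j : 0 < g (q j) by rewrite plog_gt0 // pow2_itv.
have L1 j : 1 <= C * L j by rewrite -L0 hC.
(* The head sum costs [3 * D * C], and the tail sum at most twice that, by the geometric series. *)
pose K := 3 * D * C + 6 * D * C.
have K0 : 0 < K by rewrite addr_gt0 // !mulr_gt0.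
have DC : 0 < D * C by rewrite mulr_gt0.
apply: (@abstract_reduction R f g kappa (g 16^-1)^-1 (f 2^-1)^-1 K D').
- by move=> x; exact: plog_ge0.
- exact: plog0.
- by move=> x y; exact: plog_le.
- by rewrite invr_gt0.
- move=> x x01; rewrite ler_pdivlMl // mulrC.
  by apply: plog_supermul => //; lra.
- by move=> x; exact: plog_ge0.
- exact: plog0.
- by move=> x y; apply: plog_le => //; exact: b0_ge1.
- by rewrite invr_gt0.
- move=> x x01; rewrite ler_pdivlMl // mulrC.
  by apply: plog_supermul => //; lra.
- exact: k01.
- exact: K0.
- move=> j; apply: (@le_trans _ _ (\sum_(0 <= k < j.+1) D * g (q j) * lam k)).
    apply: ler_sum_nat => k /andP[_]; rewrite ltnS => /hk /andP[_].
    by rewrite mulrAC.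
  rewrite -mulr_sumr lam_sum LE.
  (* [Lmax j <= C * L j], and the sum of powers is at most [2 <= 2 * C * L j]. *)
  have h : Lmax j + \sum_(0 <= k < j.+1) q k <= 3 * C * L j.
    by have := sum_pow2_le (R := R) j.+1; have := hLm j; have := L1 j; lra.
  apply: le_trans (_ : D * g (q j) * (3 * C * L j) <= _).
    by rewrite ler_pM2l // mulr_gt0.
  have : 0 < D * C * (L j * g (q j)) by apply: mulr_gt0 => //; rewrite mulr_gt0 ?L_gt0.
  by rewrite /K; lra.
- move=> j n; apply: (@le_trans _ _ (\sum_(j <= k < n) 3 * D * C * f (q j) * q (k - j))).
    apply: ler_sum_nat => k /andP[jk _].
    have := hk k k (leqnn k); rewrite subnn expr0 mulr1 => /andP[_ h].
    apply: le_trans h _.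
    have lamL : lam k <= 3 * C * L k.
      by apply: le_trans (lam_le k) _; have := hLm k; have := L1 k; lra.
    apply: (@le_trans _ _ (3 * D * C * f (q k))).
      rewrite LE; apply: (@le_trans _ _ (D * (3 * C * L k) * g (q k))).
        by rewrite ler_pM2r // ler_pM2l.
      by rewrite le_eqVlt; apply/orP; left; apply/eqP; ring.
    rewrite -[leRHS]mulrA ler_pM2l ?mulr_gt0 //.
    have /andP[qj0 qj1] := pow2_itv j; have /andP[qk0 qk1] := pow2_itv k.
    have kE : q k = q (k - j) * q j by rewrite -exprD subnK.
    have qkj : q k <= q j by rewrite ler_wiXn2l // ?invr_ge0 // invf_le1 // ler1n.
    (* As [f x / x] is nondecreasing, [f (q k)] decays at least geometrically from [f (q j)]. *)
    have h' : f (q k) * q j <= f (q j) * q k.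
      by apply: plog_mul_le => //; rewrite (ltW qk0).
    by rewrite -(ler_pM2r qj0) -[leRHS]mulrA -kE.
  have -> : \sum_(j <= k < n) 3 * D * C * f (q j) * q (k - j) =
      3 * D * C * f (q j) * \sum_(0 <= i < n - j) q i.
    rewrite -mulr_sumr -[in LHS](add0n j) big_addn; congr (_ * _).
    by apply: eq_bigr => i _; rewrite addnK.
  have fq : 0 < f (q j) by rewrite plog_gt0 // pow2_itv.
  apply: (@le_trans _ _ (3 * D * C * f (q j) * 2)).
    by rewrite ler_pM2l ?sum_pow2_le // !mulr_gt0.
  have : 0 < D * C * f (q j) by rewrite !mulr_gt0.
  by rewrite /K; lra.
- exact: D'0.
- move=> j; apply: (@le_trans _ _ (\sum_(0 <= k < j.+1) D' * g (q j) * lam k)); last first.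
    apply: ler_sum_nat => k /andP[_]; rewrite ltnS => /hk /andP[h _].
    by rewrite mulrAC.
  rewrite -mulr_sumr lam_sum LE [L j * _]mulrC mulrA ler_pM2l ?mulr_gt0 //.
  by apply: le_trans (L_le_Lmax j) _; rewrite lerDl sumr_ge0.
Qed.

End PowerLogReduction.

(** * Chains and the quasi-triangle inequality for the functions [plog] *)

Section PowerLogNonReduction.
Context {R : realType}.

Lemma dist_le_sum (k : nat) (z : nat -> R) :
  `|z 0%N - z k| <= \sum_(0 <= i < k) `|z i - z i.+1|.
Proof.
elim: k => [|k IHk]; first by rewrite subrr normr0 big_geq.
rewrite big_nat_recr //=; apply: le_trans (lerD IHk (lexx _)).
exact: ler_distD.
Qed.

Lemma dist_01 (x y : R) : 0 <= x <= 1 -> 0 <= y <= 1 -> 0 <= `|x - y| <= 1.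
Proof. by rewrite normr_ge0 ler_norml /=; lra. Qed.

Variables (a : nat -> R) (N : nat).
Hypothesis a_ge0 : forall i, 0 <= a i.
Hypothesis a0_ge1 : 1 <= a 0%N.
Local Notation f := (plog a N).

(* The chord of [f] from [0] to [D / (2 k)] bounds [f] from below beyond that point, as
   [f x / x] is nondecreasing; the line is negative before [D / (2 k)] after shifting. *)
Lemma plog_chain k (z : nat -> R) : (0 < k)%N -> (forall i, 0 <= z i <= 1) ->
  f 2^-1 * k%:R * f k%:R^-1 * f `|z 0%N - z k| <= \sum_(0 <= i < k) f `|z i - z i.+1|.
Proof.
move=> k0 z01; set D := `|z 0%N - z k|.
have D01 : 0 <= D <= 1 by exact: dist_01.
have d01 i : 0 <= `|z i - z i.+1| <= 1 by exact: dist_01.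
have [D0|D0] := eqVneq D 0.
  by rewrite D0 plog0 mulr0 sumr_ge0 // => i _; rewrite plog_ge0.
have D_gt0 : 0 < D by rewrite lt_def D0 normr_ge0.
have kR : 0 < k%:R :> R by rewrite ltr0n.
have k01 : 0 < (k%:R^-1 : R) <= 1 by rewrite invr_gt0 kR invf_le1 // ler1n.
pose x := D * (2^-1 * k%:R^-1).
have x01 : 0 < x <= 1.
  rewrite /x; have /andP[y0 y1] := k01; have /andP[_ D1] := D01.
  by move: (k%:R^-1) y0 y1 => y y0 y1; nra.
have x0 : 0 < x by case/andP: x01.
have line i : (`|z i - z i.+1| - x) * (f x / x) <= f `|z i - z i.+1|.
  have fx : 0 <= f x / x by rewrite divr_ge0 ?plog_ge0 // ltW //; case/andP: x01.
  have [tx|xt] := leP `|z i - z i.+1| x.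
    by apply: (@le_trans _ _ 0); [rewrite mulr_le0_ge0 // subr_le0 | rewrite plog_ge0].
  apply: (@le_trans _ _ (`|z i - z i.+1| * (f x / x))).
    by rewrite ler_wpM2r // gerBl ltW.
  rewrite mulrA ler_pdivrMr // mulrC; apply: plog_mul_le => //; first by rewrite !ltW.
  by case/andP: (d01 i).
apply: (@le_trans _ _ (\sum_(0 <= i < k) (`|z i - z i.+1| - x) * (f x / x))); last first.
  exact: ler_sum.
rewrite -mulr_suml sumrB sumr_const_nat subn0.
have xk : x *+ k = D / 2.
  by rewrite -mulr_natr /x mulrA -mulrA mulVf ?mulr1 // gt_eqF.
have hs : D / 2 <= \sum_(0 <= i < k) `|z i - z i.+1| - x *+ k.
  by have := dist_le_sum k z; rewrite xk -/D; lra.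
apply: (@le_trans _ _ (D / 2 * (f x / x))); last first.
  by rewrite ler_wpM2r // divr_ge0 ?plog_ge0 // ltW //; case/andP: x01.
have -> : D / 2 * (f x / x) = k%:R * f x.
  by rewrite -xk -[X in X * _ = _]mulr_natr mulrC mulrA divfK ?gt_eqF // mulrC.
(* [x] is the product of [D], [2^-1] and [k%:R^-1], and supermultiplicativity is applied twice. *)
have h : f D * (f 2^-1 * f k%:R^-1) <= f x.
  apply: le_trans (plog_supermul a N a_ge0 _ _ D01 _).
    rewrite ler_wpM2l ?plog_ge0 //; apply: plog_supermul => //; first by lra.
    by case/andP: k01 => /ltW ->.
  rewrite mulr_ge0 ?invr_ge0 //= ?(ltW kR) // mulr_ile1 ?invr_ge0 ?(ltW kR) //.
    by rewrite invf_le1 // ler1n.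
  by case/andP: k01.
have := ler_wpM2l (ltW kR) h; lra.
Qed.

Lemma plog_triangle x y z : 0 <= x <= 1 -> 0 <= y <= 1 -> 0 <= z <= 1 ->
  f `|x - z| <= (f 2^-1)^-1 * (f `|x - y| + f `|y - z|).
Proof.
move=> x01 y01 z01; apply: plog_quasi_triangle => //; try exact: dist_01.
  by rewrite normr_ge0 /=; exact: ler_distD.
by case/andP: (dist_01 _ _ x01 z01).
Qed.

End PowerLogNonReduction.

Lemma plog_strictly_reducible (R : realType) (a b : nat -> R) (N p : nat) :
  (p <= N)%N -> (forall i, (i < p)%N -> a i = b i) -> a p < b p ->
  (forall i, 0 <= a i) -> (forall i, 0 <= b i) -> 1 <= a 0%N ->
  strictly_borel_reducible (Erel (plog a N)) (Erel (plog b N)).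
Proof.
move=> pN ab_eq ab_lt a_ge0 b_ge0 a0_ge1.
split; first exact: (plog_reducible a b N p).
have inv01 m : (0 < m)%N -> 0 < (m%:R^-1 : R) <= 1.
  by move=> m0; rewrite invr_gt0 ltr0n m0 invf_le1 ?ltr0n // ler1n.
have [|e e0|m [m0 gm fm]] := @separating_sequence R (fun m => plog a N m%:R^-1)
    (fun m => plog b N m%:R^-1).
- move=> m /inv01 m01; rewrite plog_gt0 //=.
  by apply: le_trans (plog_le_id a N a_ge0 a0_ge1 _ _) _; case/andP: m01 => // /ltW ->.
- exact: plog_ratio_small ab_lt _ e0.
have f2 : 0 < plog a N 2^-1 by apply: plog_gt0; lra.
apply: (@not_borel_reducible R (plog a N) (plog b N) (plog a N 2^-1)^-1 (plog a N 2^-1) m) => //.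
- by move=> x; exact: plog_ge0.
- exact: plog0.
- by rewrite invr_gt0.
- by move=> x y z; exact: plog_triangle.
- move=> e e0; exists (Num.min e 1); first by rewrite lt_min e0 ltr01.
  move=> x /andP[x0]; rewrite le_min => /andP[xe x1].
  by apply: le_trans xe; apply: plog_le_id; rewrite // x0.
- by move=> k z; exact: plog_chain.
- by move=> x; exact: plog_ge0.
- exact: plog0.
- by rewrite plog1.
Qed.

(** * Translation between exponent sequences and lists *)

Section Translation.
Context {R : realType}.
Implicit Types (alpha : R) (eta : seq R).

Lemma Erel_ext (f g : R -> R) : (forall x, 0 <= x <= 1 -> f x = g x) -> Erel f = Erel g.
Proof.
move=> fg; apply/funext => x; apply/funext => y; rewrite /Erel.
congr (is_true (_ < _)%E); apply: eq_eseriesr => n _; congr (_%:E); apply: fg.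
exact: dist_01 (cube_coord_itv y n) (cube_coord_itv x n).
Qed.

(** Padding [eta] with zeros up to length [N] leaves the function unchanged and makes both products
    range over the same indices. *)
Lemma Id_pow_div_plog alpha eta N x : (size eta <= N)%N -> 0 <= x <= 1 ->
  Id_pow_div alpha eta x = plog (nth 0 (alpha :: eta)) N x.
Proof.
move=> eN /andP[]; rewrite le_eqVlt => /orP[/eqP <- _|x0 x1].
  by rewrite /Id_pow_div eqxx plog0.
rewrite -(@Id_pow_div_zero_extension R alpha eta (eta ++ nseq (N - size eta) 0)); last first.
  by exists (N - size eta)%N.
rewrite /Id_pow_div gt_eqF // plogE //; congr (_ / _).
rewrite /lprod size_cat size_nseq subnKC //; apply: eq_bigr => i _.
by rewrite tlog_tau // nth_cat nth_nseq if_same; case: ltnP => //= /(nth_default 0) ->.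
Qed.

(** With missing entries read as [0], the order is decided at an index where the entries really
    differ, unless [eta'] only appends zeros to [eta]; by nonnegativity the first nonzero additional
    entry is positive. *)
Lemma lex_lt_first_difference (eta eta' : seq R) :
  (forall e : R, e \in eta -> 0 <= e) -> (forall e : R, e \in eta' -> 0 <= e) ->
  lex_lt eta eta' -> ~ zero_extension eta eta' ->
  exists p, [/\ (p < size eta')%N, forall i, (i < p)%N -> nth 0 eta i = nth 0 eta' i &
    nth 0 eta p < nth 0 eta' p].
Proof.
elim: eta' eta => [|e' eta' IH] [|e eta] eta_ge0 eta'_ge0 lt nz.
- by case: nz; exists 0%N.
- by move: lt; rewrite /lex_lt lt_neqAle lexis0; case/andP => /negP.
- have [e'0|e'0] := eqVneq e' 0.
    have [||||p [pe pi plt]] := IH [::].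
    + by [].
    + by move=> e ee; apply: eta'_ge0; rewrite inE ee orbT.
    + rewrite /lex_lt lt_neqAle lexi0s andbT; apply/eqP => e; apply: nz.
      by exists 1%N; rewrite -e e'0.
    + by move=> [k ek]; apply: nz; exists k.+1; rewrite e'0 /= ek.
    rewrite nth_nil in plt; exists p.+1; split => //.
    by case=> [_|i ip] /=; [rewrite e'0 | rewrite -(pi i ip) nth_nil].
  exists 0%N; split => //=; rewrite lt_def e'0 /=.
  by apply: eta'_ge0; rewrite mem_head.
have [ee'|ee'] := eqVneq e e'; last first.
  exists 0%N; split => //=; move: lt; rewrite /lex_lt => /ltW.
  by rewrite neqhead_lexiE.
subst e'.
have [||||p [pe pi plt]] := IH eta.
- by move=> x xe; apply: eta_ge0; rewrite inE xe orbT.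
- by move=> x xe; apply: eta'_ge0; rewrite inE xe orbT.
- by move: lt; rewrite /lex_lt eqhead_ltxiE.
- by move=> [k ek]; apply: nz; exists k; rewrite ek.
by exists p.+1; split => //; case.
Qed.

End Translation.

(** Prepending the power to the list lets a single lexicographic comparison cover equal and
    different powers. *)
Lemma Id_pow_div_strictly_reducible (R : realType) (alpha alpha' : R) (eta eta' : seq R) (p : nat) :
  1 <= alpha -> 0 <= alpha' ->
  (forall e : R, e \in eta -> 0 <= e) -> (forall e : R, e \in eta' -> 0 <= e) ->
  (p <= size eta')%N ->
  (forall i, (i < p)%N -> nth 0 (alpha :: eta) i = nth 0 (alpha' :: eta') i) ->
  nth 0 (alpha :: eta) p < nth 0 (alpha' :: eta') p ->
  strictly_borel_reducible (Erel (Id_pow_div alpha eta)) (Erel (Id_pow_div alpha' eta')).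
Proof.
move=> alpha1 alpha'0 eta0 eta'0 pe pi plt.
pose N := maxn (size eta) (size eta').
have nth_ge0 c (s : seq R) : 0 <= c -> (forall e, e \in s -> 0 <= e) ->
    forall i, 0 <= nth 0 (c :: s) i.
  move=> c0 s0 [|i] //=; have [si|si] := leqP (size s) i; first by rewrite nth_default.
  by apply: s0; exact: mem_nth.
have -> : Erel (Id_pow_div alpha eta) = Erel (plog (nth 0 (alpha :: eta)) N).
  by apply: Erel_ext => x; apply: Id_pow_div_plog; rewrite leq_maxl.
have -> : Erel (Id_pow_div alpha' eta') = Erel (plog (nth 0 (alpha' :: eta')) N).
  by apply: Erel_ext => x; apply: Id_pow_div_plog; rewrite leq_maxr.
apply: (@plog_strictly_reducible R _ _ N p) => //.
- by rewrite (leq_trans pe) // leq_maxr.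
- by apply: nth_ge0 => //; exact: le_trans ler01 alpha1.
- exact: nth_ge0.
Qed.

Theorem corollary30 (R : realType) (alpha beta : R) (eta eta' : seq R)
  (one_le_alpha : 1 <= alpha) (alpha_lt_beta : alpha < beta)
  (eta_in : forall e : R, e \in eta -> 0 <= e < 1)
  (eta'_in : forall e : R, e \in eta' -> 0 <= e < 1)
  (eta_lt_eta' : lex_lt eta eta') :
  [/\ ~ zero_extension [::] eta ->
        strictly_borel_reducible (Erel (Id_pow alpha))
                                 (Erel (Id_pow_div alpha eta)),
      ~ zero_extension eta eta' ->
        strictly_borel_reducible (Erel (Id_pow_div alpha eta))
                                 (Erel (Id_pow_div alpha eta'))
    & strictly_borel_reducible (Erel (Id_pow_div alpha eta'))
                               (Erel (Id_pow beta))].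
Proof.
have alpha0 : 0 < alpha by apply: lt_le_trans ltr01 one_le_alpha.
have beta0 : 0 < beta by apply: lt_trans alpha0 alpha_lt_beta.
have eta_ge0 e : e \in eta -> 0 <= e by move=> /eta_in/andP[].
have eta'_ge0 e : e \in eta' -> 0 <= e by move=> /eta'_in/andP[].
have Id_powE c : 0 < c -> Id_pow c = Id_pow_div c [::].
  by move=> c0; apply/funext => x; rewrite Id_pow_div_nil // gt_eqF.
have same_exponent (s s' : seq R) : (forall e : R, e \in s -> 0 <= e) ->
    (forall e : R, e \in s' -> 0 <= e) -> lex_lt s s' -> ~ zero_extension s s' ->
    strictly_borel_reducible (Erel (Id_pow_div alpha s)) (Erel (Id_pow_div alpha s')).
  move=> s0 s'0 lt nz; have [p [ps pi plt]] := lex_lt_first_difference s s' s0 s'0 lt nz.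
  (* The index is shifted by one because [alpha] is prepended. *)
  by apply: (@Id_pow_div_strictly_reducible R alpha alpha s s' p.+1) => //;
     [exact: ltW | case].
rewrite !Id_powE //; split.
- move=> nz; apply: same_exponent => //.
  rewrite /lex_lt lt_neqAle lexi0s andbT; apply/eqP => e; apply: nz.
  by exists 0%N; rewrite -e.
- exact: same_exponent.
(* The powers [alpha < beta] already differ at index [0], whatever [eta'] is. *)
- by apply: (@Id_pow_div_strictly_reducible R alpha beta eta' [::] 0) => //; exact: ltW.
Qed.
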